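(* Let $k$ be even and $\ell=k/2$. (1) The components of $\mathbf{DCM}_k$ of smallest order have exactly $2$ vertices, and there are exactly $\ell\cdot 2^{\ell-1}$ of them. (2) For $k\ge 4$, the components of $\mathbf{DCM}_k$ of second smallest order have exactly $6\ell-6$ vertices, and for $k\ge 6$ there are exactly $\ell\cdot 2^{\ell-2}$ of them.
   Context: Let $k\ge 1$ and let $X_{2k}=\{P_1,\dots,P_{2k}\}$ be $2k$ points in convex position in the plane, labeled in clockwise cyclic order; indices are taken modulo $2k$. A matching of $X_{2k}$ means a set of $k$ pairwise non-crossing straight segments (edges) with endpoints in $X_{2k}$ covering every point exactly once; its size is $k$. Two matchings $M,M'$ of $X_{2k}$ are disjoint compatible if they have no common edge and no edge of $M$ crosses an edge of $M'$. $\mathbf{DCM}_k$ is the graph whose vertices are the matchings of $X_{2k}$, two being adjacent iff they are disjoint compatible. The order of a component is its number of vertices. *)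

(* Defs.v *)
From HB Require Import structures.
From mathcomp Require Import all_boot.
Set Implicit Arguments. Unset Strict Implicit. Unset Printing Implicit Defensive.

(* Points P_1..P_{2k} in convex position, clockwise, are modelled by the
   labels 0..2k-1 : 'I_(k.*2) (cyclic order = order of labels).
   A (straight) edge is a 2-element set of points. *)

Definition pt (k : nat) := 'I_(k.*2).
Definition edge_t (k : nat) := {set pt k}.
Definition matching_t (k : nat) := {set edge_t k}.

(* For points in convex position, two segments with four distinct endpoints
   cross iff their endpoints interleave in the cyclic order; segments sharing
   an endpoint meet only there and do not cross. *)
Definition interleave k (e1 e2 : edge_t k) : bool :=
  [exists a : pt k, exists b : pt k, exists c : pt k, exists d : pt k,
    [&& a \in e1, b \in e1, c \in e2, d \in e2,
        (a < c)%N, (c < b)%N & (b < d)%N]].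

Definition crosses k (e1 e2 : edge_t k) : bool :=
  interleave e1 e2 || interleave e2 e1.

Definition is_matching k (M : matching_t k) : bool :=
  [&& [forall e in M, #|e| == 2],
      [forall x : pt k, #|[set e in M | x \in e]| == 1] &
      [forall e1 in M, forall e2 in M, ~~ crosses e1 e2]].

Definition disj_compat k (M M' : matching_t k) : bool :=
  [disjoint M & M'] && [forall e in M, forall e' in M', ~~ crosses e e'].

Definition dcm k : rel (matching_t k) :=
  fun M M' => [&& is_matching M, is_matching M' & disj_compat M M'].

Definition component k (M : matching_t k) : {set matching_t k} :=
  [set M' | connect (@dcm k) M M'].

Definition components k : {set {set matching_t k}} :=
  [set component M | M in [set M : matching_t k | is_matching M]].

(* Main.v *)
(** The union of two adjacent matchings is a set of non-crossing even polygons.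
If the number of edges is even, every matching contains two edges on four
consecutive points; deleting this quadrilateral commutes with adjacency, up to
switching the two matchings of the quadrilateral at every move, which makes
induction on the number of quadrilaterals possible.

A matching is small when it comes from a chain of quadrilaterals, each hanging
from a side of the previous one adjacent to the side by which that one hangs,
and matched so that no move other than switching all of them exists.  If exactly
one consecutive pair of the chain is replaced by an octagon, the octagon can be
shifted along the chain: this is the medium component, with six vertices for
each of the l-1 positions.  Putting a quadrilateral in any gap of a small or
medium matching gives a small or medium matching or one that reduces to one of
finitely many matchings with at most 16 points.  The latter lie in components
that contain the matching with all its edges on the hull (with one exceptional
component on 16 points), and their order at least doubles with each further
quadrilateral.

A small component consists of two, and a medium component contains exactly two,
of the rotations of two (respectively four) consecutive hull edges followed by a
chain; these rotations are pairwise distinct, which gives the counts. *)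

From Stdlib Require Import Ascii String.
Require Import Defs.
From HB Require Import structures.
From mathcomp Require Import all_boot.
From mathcomp Require Import zify.
Set Implicit Arguments. Unset Strict Implicit. Unset Printing Implicit Defensive.

(** * Matchings as plane forests *)

(** Walks do not lift unchanged to a matching with an inserted quadrilateral: after an odd number of
    moves the other matching of the quadrilateral appears. For the medium components, therefore,
    both [quadA] and [quadB] are tried in every gap of one representative, up to rotation.

    Chains have unbounded length, so these cases are not finite by themselves. They become so
    because bigness is inherited when quadrilaterals are added: a chain with variable bits may be
    cut down to nothing, or to one quadrilateral where its presence matters, and what remains is a
    closed term decided by evaluation.

    As for the counts, there are 4l points. Two hull edges followed by a chain admit 4l rotations
    and 2^(l-2) chains, as the last bit is immaterial; with four hull edges there are 2^(l-3)
    chains. Halving gives l * 2^(l-1) and l * 2^(l-2). If the chain is empty, rotations coincide;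
    this is why l = 1 is treated apart in the first count and the second one starts at k = 6. *)

Inductive dyck := dnil | arch (u v : dyck).

Fixpoint dyck_eqb (x y : dyck) : bool :=
  match x, y with
  | dnil, dnil => true
  | arch u v, arch u' v' => dyck_eqb u u' && dyck_eqb v v'
  | _, _ => false
  end.

Lemma dyck_eqP : Equality.axiom dyck_eqb.
Proof.
elim=> [|u IHu v IHv] [|u' v'] /=; try by constructor.
apply: (iffP andP) => [[/(IHu u')-> /(IHv v')->]|[<- <-]] //.
by split; [apply/IHu|apply/IHv].
Qed.

HB.instance Definition _ := hasDecEq.Build dyck dyck_eqP.

Fixpoint dcat (x y : dyck) : dyck :=
  if x is arch u v then arch u (dcat v y) else y.
Infix "@+" := dcat (at level 60, right associativity).

Definition leaf := arch dnil dnil.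
Definition wrap u := arch u dnil.

Fixpoint dsz (d : dyck) : nat :=
  if d is arch u v then (dsz u + dsz v).+1 else 0.

(* Relabels every point [i] as [i - 1], modulo the number of points. *)
Definition drot (d : dyck) : dyck :=
  if d is arch u v then u @+ arch v dnil else dnil.

(* The forest [d] occupies [(dsz d).*2] points, of which [o] is the first. *)
Fixpoint edges (o : nat) (d : dyck) : seq (nat * nat) :=
  if d is arch u v then
    (o, (o + (dsz u).*2).+1) :: edges o.+1 u ++ edges (o + (dsz u).*2).+2 v
  else [::].

Definition cross (e f : nat * nat) : bool :=
  [&& e.1 < f.1, f.1 < e.2 & e.2 < f.2] || [&& f.1 < e.1, e.1 < f.2 & f.2 < e.2].

Definition compat (e f : nat * nat) : bool := (e != f) && ~~ cross e f.

Definition adj (d d' : dyck) : bool :=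
  (dsz d == dsz d') && allrel compat (edges 0 d) (edges 0 d').

Lemma dcatA x y z : (x @+ y) @+ z = x @+ y @+ z.
Proof. by elim: x => //= u _ v ->. Qed.

Lemma dcat0 x : x @+ dnil = x.
Proof. by elim: x => //= u _ v ->. Qed.

Lemma dsz_cat x y : dsz (x @+ y) = dsz x + dsz y.
Proof. by elim: x => //= u _ v ->; rewrite addSn addnA. Qed.

Lemma dsz_rot d : dsz (drot d) = dsz d.
Proof. by case: d => //= u v; rewrite dsz_cat /= addn0 addnS. Qed.

Lemma dcat_inj x x' y y' : dsz x = dsz x' -> x @+ y = x' @+ y' -> x = x' /\ y = y'.
Proof.
move=> hs h.
suff: forall n x x', dsz x + dsz x' <= n -> dsz x = dsz x' -> x @+ y = x' @+ y' -> x = x' /\ y = y'.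
  by move/(_ _ x x' (leqnn _) hs h).
move=> n; elim: n => [|n IH] {h hs}x {}x'.
  by case: x => [|u v] //; case: x' => [|u' v'] //= .
case: x => [|u v]; case: x' => [|u' v'] //= hn hs [h1 h2]; subst u'.
have [||-> ->] := IH v v' _ _ h2; first lia; first lia; by split.
Qed.

Lemma edges_range o d (e : nat * nat) : e \in edges o d ->
  [/\ o <= e.1, e.1 < e.2, e.2 < o + (dsz d).*2 & odd (e.2 - e.1)].
Proof.
elim: d o => // u IHu v IHv o /=; rewrite inE mem_cat => /or3P[/eqP->|/IHu|/IHv] /=.
- split; try lia; by rewrite -addnS addKn /= odd_double.
- case=> h1 h2 h3 h4; split=> //; lia.
- case=> h1 h2 h3 h4; split=> //; lia.
Qed.

Lemma edges_cat o x y : edges o (x @+ y) = edges o x ++ edges (o + (dsz x).*2) y.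
Proof.
elim: x o => [|u _ v IHv] o /=; first by rewrite addn0.
rewrite IHv -!catA; congr (_ :: _ ++ _ ++ edges _ _); lia.
Qed.

Definition eshift k (e : nat * nat) := (k + e.1, k + e.2).

Lemma edges_shift k o d : edges (k + o) d = map (eshift k) (edges o d).
Proof.
elim: d o => //= u IHu v IHv o; rewrite map_cat -IHu -IHv.
rewrite /eshift /= !addnS !addnA; congr (_ :: _ ++ _).
Qed.

Lemma compat_shift k e f : compat (eshift k e) (eshift k f) = compat e f.
Proof.
rewrite /compat /cross /eshift; case: e f => [a b] [c d] /=; rewrite !xpair_eqE.
by rewrite !eqn_add2l !ltn_add2l.
Qed.

Lemma compatC e f : compat e f = compat f e.
Proof. by rewrite /compat eq_sym /cross orbC. Qed.

Lemma allrel_edges k d d' :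
  allrel compat (edges k d) (edges k d') = allrel compat (edges 0 d) (edges 0 d').
Proof.
rewrite -[k]addn0 !edges_shift /allrel all_map; apply: eq_all => e /=.
by rewrite all_map; apply: eq_all => f /=; rewrite compat_shift.
Qed.

Lemma adjC d d' : adj d d' = adj d' d.
Proof.
by rewrite /adj eq_sym allrelC; congr andb; apply: eq_allrel => e f; rewrite compatC.
Qed.

Lemma adj_sz d d' : adj d d' -> dsz d = dsz d'.
Proof. by case/andP=> /eqP. Qed.

Lemma compat_sep a b d d' (e f : nat * nat) :
  e \in edges a d -> f \in edges b d' -> a + (dsz d).*2 <= b -> compat e f.
Proof.
move=> /edges_range[h1 h2 h3 _] /edges_range[h4 h5 h6 _] h.
rewrite /compat /cross; case: e f h1 h2 h3 h4 h5 h6 => [a1 b1] [a2 b2] /= *.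
rewrite xpair_eqE; lia.
Qed.

(** Edges in disjoint intervals neither coincide nor cross, so for blocks of equal size adjacency is
    decided blockwise. This makes deletion of a quadrilateral compatible with moves. *)
Lemma adj_cat x x' y y' : dsz x = dsz x' ->
  adj (x @+ y) (x' @+ y') = adj x x' && adj y y'.
Proof.
move=> hs; rewrite /adj !dsz_cat !edges_cat hs eqn_add2l eqxx /=.
rewrite allrel_catl !allrel_catr -!andbA allrel_edges.
have -> : allrel compat (edges 0 x) (edges (0 + (dsz x').*2) y') = true.
  by apply/allrelP => e f he hf; apply: compat_sep he hf _; rewrite hs.
have -> : allrel compat (edges (0 + (dsz x').*2) y) (edges 0 x') = true.
  by apply/allrelP => e f he hf; rewrite compatC; apply: compat_sep hf he _.
by case: (dsz y == _); rewrite /= ?andbF.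
Qed.

Lemma adj_catI x x' y y' : adj x x' -> adj y y' -> adj (x @+ y) (x' @+ y').
Proof. by move=> h1 h2; rewrite adj_cat ?h1 ?h2 //; apply: adj_sz. Qed.

Definition erot n (e : nat * nat) : nat * nat :=
  if e.1 == 0 then (e.2.-1, n.-1) else (e.1.-1, e.2.-1).

Lemma edges_rot d : edges 0 (drot d) =i map (erot (dsz d).*2) (edges 0 d).
Proof.
case: d => //= u v e.
rewrite edges_cat /= cats0 map_cat !(mem_cat, inE).
have h k w : 0 < k -> map (erot (dsz u + dsz v).*2.+2) (edges k w) = edges k.-1 w.
  move=> hk; have -> : k = 1 + k.-1 by lia.
  rewrite [_.-1]/= edges_shift -map_comp -[RHS]map_id; apply: eq_map => -[a b].
  by rewrite /erot /eshift /=.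
rewrite !h //= !add0n /erot /=.
have -> : (dsz u).*2 + (dsz v).*2 = (dsz u + dsz v).*2 by lia.
by rewrite orbCA.
Qed.

Lemma compat_rot n e f : e.1 < e.2 < n -> f.1 < f.2 < n ->
  compat (erot n e) (erot n f) = compat e f.
Proof.
rewrite /compat /cross /erot; case: e f => [a b] [c d] /=.
by case: a => [|a]; case: c => [|c] /=; rewrite !xpair_eqE => /andP[h1 h2] /andP[h3 h4];
   have hn := ltn_predK h2; case: b h1 h2 => // b; case: d h3 h4 => // d;
   case: n hn => // n; rewrite /= !ltnS ?eqSS => *; lia.
Qed.

Lemma adj_rot d d' : adj (drot d) (drot d') = adj d d'.
Proof.
rewrite /adj !dsz_rot; case: eqP => //= hs.
rewrite /allrel (eq_all_r (edges_rot d)) all_map; apply: eq_in_all => e he /=.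
rewrite (eq_all_r (edges_rot d')) all_map -hs; apply: eq_in_all => f hf /=.
have [_ h1 h2 _] := edges_range he; have [_ h3 h4 _] := edges_range hf.
by rewrite compat_rot ?h1 // ?h3 // hs.
Qed.

Definition apart (e f : nat * nat) : bool :=
  [&& e.1 != f.1, e.1 != f.2, e.2 != f.1 & e.2 != f.2].

Lemma edges_apart o d (e f : nat * nat) : e \in edges o d -> f \in edges o d ->
  (e == f) || apart e f && ~~ cross e f.
Proof.
have sep o1 o2 d1 d2 (e1 e2 : nat * nat) : e1 \in edges o1 d1 -> e2 \in edges o2 d2 ->
    o1 + (dsz d1).*2 <= o2 -> apart e1 e2 && ~~ cross e1 e2 && (apart e2 e1 && ~~ cross e2 e1).
  move=> /edges_range[h1 h2 h3 _] /edges_range[h4 h5 h6 _] h.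
  by rewrite /apart /cross; lia.
elim: d o => // u IHu v IHv o /=; rewrite !inE !mem_cat.
have new o' x (e1 : nat * nat) : e1 \in edges o' x ->
    (o < o' /\ o' + (dsz x).*2 <= (o + (dsz u).*2).+1) \/ (o + (dsz u).*2).+1 < o' ->
    apart (o, (o + (dsz u).*2).+1) e1 && ~~ cross (o, (o + (dsz u).*2).+1) e1 &&
   (apart e1 (o, (o + (dsz u).*2).+1) && ~~ cross e1 (o, (o + (dsz u).*2).+1)).
  by move=> /edges_range[h1 h2 h3 _]; rewrite /apart /cross /=; lia.
case/or3P=> [/eqP->|he|he]; case/or3P=> [/eqP->|hf|hf]; rewrite ?eqxx //.
- by have /andP[-> _] := new _ _ _ hf ltac:(left; lia); rewrite orbT.
- by have /andP[-> _] := new _ _ _ hf ltac:(right; lia); rewrite orbT.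
- by have /andP[_ ->] := new _ _ _ he ltac:(left; lia); rewrite orbT.
- exact: IHu he hf.
- by have /andP[-> _] := sep _ _ _ _ _ _ he hf ltac:(lia); rewrite orbT.
- by have /andP[_ ->] := new _ _ _ he ltac:(right; lia); rewrite orbT.
- by have /andP[_ ->] := sep _ _ _ _ _ _ hf he ltac:(lia); rewrite orbT.
- exact: IHv he hf.
Qed.

(** The trees of a forest occupy consecutive intervals, and a cut that no edge straddles falls
    between two of them. In particular [c] is even, which later excludes cuts at odd places. *)
Lemma edges_cut o c d : c <= (dsz d).*2 ->
  (forall e : nat * nat, e \in edges o d -> ~~ (e.1 < o + c <= e.2)) ->
  exists w v, d = w @+ v /\ (dsz w).*2 = c.
Proof.
elim: d o c => [|u _ v IHv] o c /= hc h.
  by exists dnil, dnil; split=> //=; lia.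
case: (posnP c) => [->|c_gt0]; first by exists dnil, (arch u v).
have := h (o, (o + (dsz u).*2).+1); rewrite inE eqxx /= => /(_ isT) hy.
have [||w [v' [-> hw]]] := IHv (o + (dsz u).*2).+2 (c - (dsz u).*2.+2).
- by lia.
- move=> e he; have := h e; rewrite inE mem_cat he !orbT => /(_ isT).
  by have -> : (o + (dsz u).*2).+2 + (c - (dsz u).*2.+2) = o + c by lia.
by exists (arch u w), v'; split=> //=; lia.
Qed.

(* By parity, the two endpoints of the first edge of [arch u v] are matched in
   [d'] on the same side of this edge. *)
Lemma adj_split u v d' : adj (arch u v) d' ->
  (exists w' v', [/\ d' = w' @+ v', adj (wrap u) w' & adj v v']) \/
  (exists u' a b, [/\ d' = arch (u' @+ a) b, adj u u' & adj (arch dnil v) (arch a b)]).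
Proof.
move=> hadj; have hsz := adj_sz hadj; move: hadj => /andP[_ /allrelP hall].
case: d' hsz hall => [|a b] //= hsz hall.
pose y := (dsz u).*2.+1; pose z := (dsz a).*2.+1; rewrite !add0n in hall.
have hy (f : nat * nat) : f \in edges 0 (arch a b) -> compat (0, y) f.
  by move=> hf; apply: hall => //; rewrite inE eqxx.
have hz : (0, z) \in edges 0 (arch a b) by rewrite inE eqxx.
have nzy : z <> y by move=> e; have := hy _ hz; rewrite e /compat eqxx.
have hadj : adj (arch u v) (arch a b).
  by apply/andP; split; [apply/eqP|apply/allrelP].
have hl (f : nat * nat) : f \in edges 0 (arch a b) -> f.1 < y <= f.2 -> f.1 <> 0 -> f.2 = y.
  by move=> /hy; rewrite /compat /cross /=; lia.
case: (ltngtP z y) => // hzy; last first.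
  right.
  have sub (f : nat * nat) : f \in edges 1 a -> f \in edges 0 (arch a b).
    by move=> hf /=; rewrite inE mem_cat hf !orbT.
  have [||u' [a' [ea hu']]] := @edges_cut 1 (dsz u).*2 a.
  - by move: hzy; rewrite /z /y; lia.
  - move=> f hf; apply/negP => hc; rewrite add1n -/y in hc.
    (* An edge of [a] straddling the cut may not cross [(0, y)], hence ends at [y]. Then nothing
       straddles the cut just after [y], and [a] would begin with a block of [y] points, an odd
       number. *)
    have [h1 _ _ _] := edges_range hf.
    have hf2 : f.2 = y by apply: hl => //; [apply: sub|lia].
    have [||w [v' [ea hw]]] := @edges_cut 1 y a.
    + by move: hzy; rewrite /z /y; lia.
    + move=> g hg; apply/negP => hg2; have [h2 _ _ _] := edges_range hg.
      have := edges_apart (sub _ hf) (sub _ hg); have := hy _ (sub _ hg).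
      by rewrite /compat /cross /apart -pair_eqE /pair_eq /=; lia.
    + by move: hw; rewrite /y; lia.
  move: hadj; rewrite -adj_rot ea /= dcatA adj_cat; last by lia.
  case/andP=> h1 h2; exists u', a', b; split; rewrite ?ea //.
  by rewrite -adj_rot.
left.
have h0 (f : nat * nat) : f \in edges 0 (arch a b) -> f.1 = 0 -> f.2 = z.
  move=> hf h; have := edges_apart hz hf; rewrite /apart /= h eqxx orbF /=.
  by move/eqP=> <-.
have [||w [v' [ed hw]]] := @edges_cut 0 y.+1 (arch a b).
- by rewrite /y /=; lia.
- move=> f hf; apply/negP => hc; rewrite add0n in hc.
  have hf0 : f.1 <> 0 by move=> /(h0 _ hf); lia.
  have hfy : f.1 = y by move: (hy _ hf); rewrite /compat /cross /=; lia.
  have [||w [v' [ea hw]]] := @edges_cut 0 y (arch a b).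
  + by rewrite /y /=; lia.
  + move=> g hg; apply/negP => hg2; rewrite add0n in hg2.
    have hg0 : g.1 <> 0 by move=> /(h0 _ hg); lia.
    have := hl _ hg hg2 hg0.
    have := edges_apart hf hg.
    by rewrite /apart -pair_eqE /pair_eq /=; lia.
  by move: hw; rewrite /y; lia.
move: hadj; rewrite ed -[arch u v]/(wrap u @+ v) adj_cat; last by move: hw; rewrite /y /=; lia.
by case/andP=> h1 h2; exists w, v'.
Qed.

(** * Rotation classes and connectivity under moves *)

Lemma dsz_iter_rot r d : dsz (iter r drot d) = dsz d.
Proof. by elim: r => //= r <-; rewrite dsz_rot. Qed.

Lemma adj_iter_rot r d d' : adj (iter r drot d) (iter r drot d') = adj d d'.
Proof. by elim: r => //= r <-; rewrite adj_rot. Qed.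

Lemma rot_cat u w : iter (dsz u).*2 drot (u @+ w) = w @+ u.
Proof.
elim: u w => [|a IHa b IHb] w /=; first by rewrite dcat0.
have -> x : drot (drot (iter (dsz a + dsz b).*2 drot x)) =
    iter (dsz b).*2 drot (drot (iter (dsz a).*2 drot (drot x))).
  by rewrite -!iterSr -iterD -!iterS; congr (iter _ drot x); lia.
by rewrite /= IHa /= dcatA IHb dcatA.
Qed.

Lemma rot_period d : iter (dsz d).*2 drot d = d.
Proof. by rewrite -[in X in iter _ _ X](dcat0 d) rot_cat. Qed.

Lemma rot_iter_inv r d : exists s, iter s drot (iter r drot d) = d.
Proof.
have per m : iter (m * (dsz d).*2) drot d = d.
  by elim: m => // m IH; rewrite mulSn iterD IH rot_period.
exists (r * (dsz d).*2 - r); case: (posnP (dsz d)) => [h|h].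
  have -> : d = dnil by case: d h {per}.
  by have fix0 k : iter k drot dnil = dnil by [elim: k => //= k ->]; rewrite !fix0.
by rewrite -iterD subnK ?per // leq_pmulr //; lia.
Qed.

Lemma rot_inj : injective drot.
Proof.
move=> x y h; have hs : dsz x = dsz y by rewrite -dsz_rot h dsz_rot.
case: (posnP (dsz x)) => [h0|h0]; first by case: x y h0 hs {h} => [|? ?] // [|? ?].
have [m hm] : exists m, (dsz x).*2 = m.+1 by exists (dsz x).*2.-1; lia.
by rewrite -(rot_period x) -(rot_period y) -hs hm !iterSr h.
Qed.

Lemma iter_rot_inj r : injective (iter r drot).
Proof. by elim: r => //= r IH x y /rot_inj/IH. Qed.

Definition req (x y : dyck) := exists r, y = iter r drot x.

Lemma req_refl x : req x x. Proof. by exists 0. Qed.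

Lemma req_trans y x z : req x y -> req y z -> req x z.
Proof. by case=> r -> [s ->]; exists (s + r); rewrite iterD. Qed.

Lemma req_sym x y : req x y -> req y x.
Proof. by case=> r ->; have [s h] := rot_iter_inv r x; exists s. Qed.

Lemma req_rot x : req x (drot x). Proof. by exists 1. Qed.

Lemma req_cat x y : req (x @+ y) (y @+ x).
Proof. by exists (dsz x).*2; rewrite rot_cat. Qed.

Lemma req_sz x y : req x y -> dsz x = dsz y.
Proof. by case=> r ->; rewrite dsz_iter_rot. Qed.

Inductive conn : dyck -> dyck -> Prop :=
| conn_refl x : conn x x
| conn_step x y z : adj x y -> conn y z -> conn x z.

Lemma conn1 x y : adj x y -> conn x y.
Proof. by move=> h; apply: conn_step h (conn_refl _). Qed.

Lemma conn_trans y x z : conn x y -> conn y z -> conn x z.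
Proof. by elim=> // {}x {}y w h _ IH /IH; apply: conn_step. Qed.

Lemma conn_sym x y : conn x y -> conn y x.
Proof.
elim=> [z|{}x {}y z h _ IH]; first exact: conn_refl.
by apply: conn_trans IH _; apply: conn1; rewrite adjC.
Qed.

Lemma conn_sz x y : conn x y -> dsz x = dsz y.
Proof. by elim=> // {}x {}y z /adj_sz-> _ ->. Qed.

Lemma conn_iter_rot r x y : conn x y -> conn (iter r drot x) (iter r drot y).
Proof.
elim=> [z|{}x {}y z h _ IH]; first exact: conn_refl.
by apply: conn_step IH; rewrite adj_iter_rot.
Qed.

(** Every move on [x] is accompanied by a switch between [q] and [q'], so the parity of the walk
    decides between the alternatives. The induction needs both starting values. *)
Lemma conn_lift q q' x y : adj q q' -> conn x y ->
  conn (q @+ x) (q @+ y) \/ conn (q @+ x) (q' @+ y).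
Proof.
move=> hq h; suff: (conn (q @+ x) (q @+ y) \/ conn (q @+ x) (q' @+ y)) /\
  (conn (q' @+ x) (q' @+ y) \/ conn (q' @+ x) (q @+ y)) by case.
elim: h => [z|{}x {}y z hxy _ [IH1 IH2]]; first by split; left; apply: conn_refl.
have h1 : adj (q @+ x) (q' @+ y) by apply: adj_catI.
have h2 : adj (q' @+ x) (q @+ y) by apply: adj_catI; rewrite // adjC.
split; [case: IH2 => h; [right|left]|case: IH1 => h; [right|left]];
  exact: conn_step h.
Qed.

(** * Enumeration of forests and neighbours, for proofs by evaluation *)

Fixpoint forests_rec (h n : nat) : seq dyck :=
  if n is m.+1 then
    if h is h'.+1 then
      flatten [seq [seq arch u v | u <- forests_rec h' i, v <- forests_rec h' (m - i)]
              | i <- iota 0 n]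
    else [::]
  else [:: dnil].

(** The first argument is fuel; every recursive call concerns fewer edges, so [n] is enough. *)
Definition forests n := forests_rec n n.

Lemma mem_forests d : d \in forests (dsz d).
Proof.
suff h k : dsz d <= k -> d \in forests_rec k (dsz d) by apply: h.
elim: d k => [|u IHu v IHv] [|k] // hk; rewrite /= in hk.
have -> : forests_rec k.+1 (dsz (arch u v)) = flatten [seq [seq arch a b |
   a <- forests_rec k i, b <- forests_rec k (dsz u + dsz v - i)]
   | i <- iota 0 (dsz u + dsz v).+1] by [].
apply/flattenP; eexists; first by apply/mapP; exists (dsz u); rewrite ?mem_iota //=; lia.
apply/allpairsP; exists (u, v); split=> //=; first by apply: IHu; lia.
have -> : dsz u + dsz v - dsz u = dsz v by lia.
by apply: IHv; lia.
Qed.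

Definition nbrs x := [seq d <- forests (dsz x) | adj x d].

Lemma mem_nbrs x d : (d \in nbrs x) = adj x d.
Proof.
rewrite mem_filter; case h: (adj x d) => //=.
by rewrite (adj_sz h) mem_forests.
Qed.

Definition quadA := wrap leaf.
Definition quadB := leaf @+ leaf.

Lemma adj_quad : adj quadA quadB. Proof. by []. Qed.

Lemma adj_leaf d : adj leaf d = false.
Proof. by rewrite -mem_nbrs. Qed.

Lemma adj_quadB d : adj quadB d -> d = quadA.
Proof. by rewrite -mem_nbrs inE => /eqP. Qed.

Ltac dnorm :=
  rewrite /= /quadA /quadB /leaf /wrap /= ?dcatA ?dcat0 /= ?dcatA ?dcat0 /=.
(** Peels aligned blocks with known adjacency off the front, and rotates both matchings when the
    front does not split. *)
Ltac adj_strip :=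
  dnorm;
  repeat (first [done | assumption | by rewrite adjC | apply: adj_catI; [by [] || by rewrite adjC |]
                | rewrite -adj_rot]; dnorm).

(* A chain of quadrilaterals, each hanging from a side of the previous one
   adjacent to the side through which that one hangs (the bit says on which
   side); [achain] contains the side facing outwards, [bchain] does not.  The
   last bit is immaterial. *)
Fixpoint achain (ts : seq bool) : dyck :=
  if ts is t :: ts' then
    wrap (if t then leaf @+ achain ts' else achain ts' @+ leaf)
  else dnil.

Fixpoint bchain (ts : seq bool) : dyck :=
  if ts is t :: ts' then
    if t then leaf @+ wrap (bchain ts') else wrap (bchain ts') @+ leaf
  else dnil.

Lemma dsz_achain ts : dsz (achain ts) = (size ts).*2.
Proof. by elim: ts => [|[] ts IH] //=; rewrite ?dsz_cat /= IH; lia. Qed.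

Lemma adj_chain ts : adj (achain ts) (bchain ts).
Proof. by elim: ts => [|[] ts IH] //; adj_strip. Qed.

Lemma dsz_bchain ts : dsz (bchain ts) = (size ts).*2.
Proof. by rewrite -(adj_sz (adj_chain ts)) dsz_achain. Qed.

(** Chains are rigid: a move must switch all their quadrilaterals. If the block of the outer edge
    moves as a whole, a rotation exposes the shorter chain followed by [quadB], whose only neighbour
    is [quadA]. Otherwise its inside, a chain and a single edge, would move by itself, but a single
    edge has no neighbour. *)
Lemma adj_achain_cat ts d d' : adj (achain ts @+ d) d' ->
  exists2 d0, d' = bchain ts @+ d0 & adj d d0.
Proof.
elim: ts d d' => [|t ts IH] d d' /=; first by exists d'.
pose r := if t then 3 else 1.
move=> /adj_split[[w [v [-> hw hv]]]|[u [a [b [_ hu _]]]]].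
  exists v => //; congr (_ @+ _); apply: (@iter_rot_inj r).
  have : adj (achain ts @+ quadB) (iter r drot w).
    by move: hw; rewrite -(adj_iter_rot r) /r; case: (t); rewrite /wrap /= ?dcat0 ?dcatA.
  case/IH=> d0 -> /adj_quadB->; rewrite /r; case: (t); by dnorm.
exfalso; have : adj (achain ts @+ leaf) (iter (if t then 2 else 0) drot u).
  by move: hu; rewrite -(adj_iter_rot (if t then 2 else 0)); case: (t); rewrite /wrap /= ?dcat0.
by case/IH=> d0 _; rewrite adj_leaf.
Qed.

Lemma adj_bchain ts d : adj (bchain ts) d -> d = achain ts.
Proof.
elim: ts d => [|t ts IH] d; first by move/adj_sz; case: d.
pose r := if t then 3 else 1; pose R := (dsz (bchain ts)).*2 + r.
have hB : iter R drot (bchain (t :: ts)) = achain [:: true] @+ bchain ts.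
  have -> : R = (dsz (bchain ts)).*2 + r by [].
  by rewrite iterD -(@rot_cat (bchain ts)) /r; case: (t); dnorm.
have hA : iter R drot (achain (t :: ts)) = bchain [:: true] @+ achain ts.
  rewrite /R (adj_sz (etrans (adjC _ _) (adj_chain ts))).
  by rewrite iterD -(@rot_cat (achain ts)) /r; case: (t); dnorm.
rewrite -(adj_iter_rot R) hB => /adj_achain_cat[d0 hd /IH e].
by apply: (@iter_rot_inj R); rewrite hd e hA.
Qed.

Lemma adj_achain ts d : adj (achain ts) d -> d = bchain ts.
Proof.
by rewrite -[achain ts]dcat0 => /adj_achain_cat[[|? ?] -> //]; rewrite dcat0.
Qed.

(* [ext q d d']: [d'] is [d] with [q] inserted between two consecutive points. *)
Inductive ext (q : dyck) : dyck -> dyck -> Prop :=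
| ext_here d : ext q d (q @+ d)
| ext_in u u' v : ext q u u' -> ext q (arch u v) (arch u' v)
| ext_right u v v' : ext q v v' -> ext q (arch u v) (arch u v').

Lemma dsz_ext q d d' : ext q d d' -> dsz d' = dsz q + dsz d.
Proof. by elim=> [{}d|u u' v _ IH|u v v' _ IH] /=; rewrite ?dsz_cat; lia. Qed.

Lemma ext_dnil q d : ext q dnil d -> d = q.
Proof. by move=> h; inversion h; rewrite dcat0. Qed.

Lemma ext_arch q u v d : ext q (arch u v) d ->
  [\/ d = q @+ arch u v, exists2 u', ext q u u' & d = arch u' v
    | exists2 v', ext q v v' & d = arch u v'].
Proof.
move=> h; inversion h; subst; first exact: Or31.
  by apply: Or32; exists u'.
by apply: Or33; exists v'.
Qed.

Lemma ext_catr q x w w' : ext q w w' -> ext q (x @+ w) (x @+ w').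
Proof. by move=> h; elim: x => //= u _ v IH; apply: ext_right. Qed.

Lemma ext_cat q x w d : ext q (x @+ w) d ->
  (exists2 x', ext q x x' & d = x' @+ w) \/ (exists2 w', ext q w w' & d = x @+ w').
Proof.
elim: x d => [|a _ b IH] d /=; first by right; exists d.
case/ext_arch=> [->|[a' h ->]|[b' /IH[[b'' h ->]|[w' h ->]] ->]].
- by left; exists (q @+ arch a b); rewrite ?dcatA //; apply: ext_here.
- by left; exists (arch a' b) => //; apply: ext_in.
- by left; exists (arch a b'') => //; apply: ext_right.
- by right; exists w'.
Qed.

Lemma ext_end q x : ext q x (x @+ q).
Proof. by rewrite -{1}(dcat0 x); apply: ext_catr; rewrite -{2}(dcat0 q); apply: ext_here. Qed.

Lemma ext_req q d d' : ext q d d' -> exists2 e, req d e & req d' (q @+ e).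
Proof.
move=> h; suff /(_ dnil): forall w, exists2 e, req (d @+ w) e & req (d' @+ w) (q @+ e).
  by rewrite !dcat0.
elim: h => {d d'} [d|u u' v _ IH|u v v' _ IH] w.
- by exists (d @+ w); rewrite ?dcatA; apply: req_refl.
- have [e h1 h2] := IH (wrap (v @+ w)); exists e.
    exact: req_trans (req_rot (arch u (v @+ w))) h1.
  exact: req_trans (req_rot (arch u' (v @+ w))) h2.
- have [e h1 h2] := IH (w @+ wrap u); exists e.
    by apply: req_trans h1; rewrite -dcatA; apply: (req_cat (wrap u)).
  by apply: req_trans h2; rewrite -dcatA; apply: (req_cat (wrap u)).
Qed.

Lemma ext_rot q c c' : ext q (drot c) c' -> exists2 c'', ext q c c'' & req c' c''.
Proof.
case: c => [|u v] /=; first by move=> h; exists c' => //; apply: req_refl.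
case/ext_cat=> [[u' h ->]|[w' h ->]].
  by exists (arch u' v); [apply: ext_in|apply: req_sym; apply: (req_rot (arch u' v))].
case/ext_arch: h => [->|[v' h ->]|[n /ext_dnil-> ->]].
- exists (arch (u @+ q) v); first exact/ext_in/ext_end.
  by rewrite -dcatA; apply: req_sym; apply: (req_rot (arch _ _)).
- exists (arch u v'); first exact: ext_right.
  exact: req_sym (req_rot (arch _ _)).
- exists (arch (q @+ u) v); first exact/ext_in/ext_here.
  apply: req_sym; apply: req_trans (req_rot (arch _ _)) _ => /=.
  by rewrite dcatA; apply: req_trans (req_cat _ _) _; rewrite dcatA; apply: req_refl.
Qed.

(** A block in front of a rotation of [c] sits in some gap of [c] itself, so all rotations are
    covered by the gaps of one representative. *)
Lemma ext_iter_rot q r c : exists2 c', ext q c c' & req (q @+ iter r drot c) c'.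
Proof.
suff h c' : ext q (iter r drot c) c' -> exists2 c'', ext q c c'' & req c' c''.
  exact/h/ext_here.
elim: r c' => [|r IH] c'; first by move=> h; exists c' => //; apply: req_refl.
case/ext_rot=> c1 /IH[c2 h1 h2] h3; exists c2 => //; exact: req_trans h3 h2.
Qed.

Definition quad q := (q == quadA) || (q == quadB).

Lemma quad_sz q : quad q -> dsz q = 2.
Proof. by case/orP=> /eqP->. Qed.

Lemma quad_adj q : quad q -> exists2 q', quad q' & adj q q'.
Proof. by case/orP=> /eqP->; [exists quadB|exists quadA]. Qed.

(** Descend into a subforest with at least two edges as long as there is one; at the end both parts
    have at most one edge, and the front is [quadB] or [quadA]. *)
Lemma ext_quad d : 2 <= dsz d -> exists q d0, quad q /\ ext q d0 d.
Proof.
elim: d => // u IHu v IHv /= h.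
case: (leqP 2 (dsz u)) => [/IHu[q [u0 [hq hu]]]|hu].
  by exists q, (arch u0 v); split=> //; apply: ext_in.
case: (leqP 2 (dsz v)) => [/IHv[q [v0 [hq hv]]]|hv].
  by exists q, (arch u v0); split=> //; apply: ext_right.
have sz0 x : dsz x = 0 -> x = dnil by case: x.
have sz1 x : dsz x = 1 -> x = leaf.
  by case: x => //= a b [] /eqP; rewrite addn_eq0 => /andP[/eqP/sz0-> /eqP/sz0->].
have [hu0|hu1] : dsz u = 0 \/ dsz u = 1 by lia.
  rewrite (sz0 _ hu0) (sz1 v); last by lia.
  by exists quadB, dnil; split=> //; apply: (@ext_here quadB).
rewrite (sz1 _ hu1); exists quadA, v; split=> //; exact: (@ext_here quadA).
Qed.

Lemma req_quad d : 2 <= dsz d -> exists q e, [/\ quad q, dsz d = (dsz e).+2 & req d (q @+ e)].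
Proof.
case/ext_quad=> q [d0 [hq hd]]; have [e h1 h2] := ext_req hd.
by exists q, e; split=> //; rewrite (req_sz h2) dsz_cat (quad_sz hq).
Qed.

Lemma has_nbr d : ~~ odd (dsz d) -> exists d', adj d d'.
Proof.
elim: {d}(dsz d) {-2}d (leqnn (dsz d)) => [|n IH] d hn ho.
  by case: d hn {ho} => // _; exists dnil.
case: (leqP 2 (dsz d)) => h; last first.
  have {h ho hn} : dsz d = 0 by case: (dsz d) h ho => [|[|]].
  by case: d => // _; exists dnil.
have [q [e [hq he /req_sym[r ->]]]] := req_quad h.
have [||e' ae] := IH e; [lia|by move: ho; rewrite he /= negbK|].
have [q' _ aq] := quad_adj hq.
by exists (iter r drot (q' @+ e')); rewrite adj_iter_rot; apply: adj_catI.
Qed.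

(* Reads a balanced word from right to left; the stack holds the forests that
   start at the current position at each nesting level. *)
Fixpoint word_stack (w : string) : seq dyck :=
  if w is String c w' then
    if Ascii.eqb c "("%char then
      if word_stack w' is u :: v :: st then arch u v :: st else [::]
    else dnil :: word_stack w'
  else [:: dnil].

Definition word (w : string) : dyck := head dnil (word_stack w).
Arguments word w%_string_scope.

Definition ring n := iter n (arch dnil) dnil.

(* Matchings that can be turned into the 12-point matching with all edges on the
   hull by rotations, moves and deletions of quadrilaterals. *)
Inductive big : dyck -> Prop :=
| big_ring : big (ring 6)
| big_conn x y : conn x y -> big x -> big y
| big_rot x : big x -> big (drot x)
| big_quad q x : quad q -> big x -> big (q @+ x).

Lemma big_req x y : req x y -> big x -> big y.
Proof. by case=> r -> h; elim: r => //= r; apply: big_rot. Qed.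

Lemma big_unrot x : big (drot x) -> big x.
Proof. exact/big_req/req_sym/req_rot. Qed.

(** Replacement of [x] by [y] in any context: a rotation brings the replaced piece to the front, so
    contexts to its right suffice. *)
Definition bigle x y := forall w, big (x @+ w) -> big (y @+ w).

Lemma bigle_cat a b x y : bigle x y -> bigle (a @+ x @+ b) (a @+ y @+ b).
Proof.
move=> h w; rewrite !dcatA => /(big_req (req_cat _ _)); rewrite !dcatA => /h hb.
by apply: big_req (req_cat _ _) _; rewrite !dcatA.
Qed.

Lemma bigle_wrap x y : bigle x y -> bigle (wrap x) (wrap y).
Proof. by move=> h w /big_rot /= /h hb; apply: big_unrot. Qed.

Lemma bigle_quad q : quad q -> bigle dnil q.
Proof. by move=> hq w; apply: big_quad. Qed.

Lemma bigle_trans y x z : bigle x y -> bigle y z -> bigle x z.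
Proof. by move=> h1 h2 w /h1/h2. Qed.

Lemma bigle_achain1 t ts : bigle dnil (achain ts) -> bigle quadA (achain (t :: ts)).
Proof.
move=> IH; apply: bigle_wrap; case: (t).
  by have := @bigle_cat leaf dnil _ _ IH; rewrite !dcat0.
exact: (@bigle_cat dnil leaf _ _ IH).
Qed.

Lemma bigle_achain ts : bigle dnil (achain ts).
Proof.
elim: ts => // t ts IH; apply: (@bigle_trans quadA); first exact: bigle_quad.
exact: bigle_achain1.
Qed.

Lemma bigle_bchain1 t ts : bigle dnil (bchain ts) -> bigle quadB (bchain (t :: ts)).
Proof.
move=> /bigle_wrap IH /=; case: (t).
  by have := @bigle_cat leaf dnil _ _ IH; rewrite !dcat0.
exact: (@bigle_cat dnil leaf _ _ IH).
Qed.

Lemma bigle_bchain ts : bigle dnil (bchain ts).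
Proof.
elim: ts => // t ts IH; apply: (@bigle_trans quadB); first exact: bigle_quad.
exact: bigle_bchain1.
Qed.

(** Keeps one quadrilateral of the chain, for places where the chain may not be dropped
    altogether. *)
Lemma bigle_acore t ts : bigle quadA (achain (t :: ts)).
Proof. exact/bigle_achain1/bigle_achain. Qed.

Lemma bigle_bcore t ts : bigle quadB (bchain (t :: ts)).
Proof. exact/bigle_bchain1/bigle_bchain. Qed.

Definition closure k (l : seq dyck) : seq dyck :=
  iter k (fun l => undup (l ++ flatten (map nbrs l))) l.

(** There are 36 matchings in this list, all within three moves of [ring 6]; it is computed once and
    for all. *)
Definition ring6_component : seq dyck := Eval vm_compute in closure 3 [:: ring 6].

Lemma mem_closure (P : dyck -> Prop) k l :
  (forall x y, conn x y -> P x -> P y) -> (forall x, x \in l -> P x) ->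
  forall x, x \in closure k l -> P x.
Proof.
move=> hP; elim: k => //= k IH hl x; rewrite mem_undup mem_cat.
case/orP=> [|/flattenP[s /mapP[y hy ->]]]; first exact: IH.
by rewrite mem_nbrs => /conn1/hP; apply; apply: IH.
Qed.

Lemma big_ring6_component x : x \in ring6_component -> big x.
Proof.
have -> : ring6_component = closure 3 [:: ring 6] by vm_compute.
apply: mem_closure; first exact: big_conn.
by move=> y; rewrite inE => /eqP->; apply: big_ring.
Qed.

Definition quad_off (d : dyck) : bool :=
  match d with
  | arch dnil (arch dnil v) => v \in ring6_component
  | arch (arch dnil dnil) v => v \in ring6_component
  | _ => false
  end.

(** Only matchings with 8 edges can pass [quad_off], and these have 16 rotations. *)
Definition quad_rot d := has (fun r => quad_off (iter r drot d)) (iota 0 16).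

(* Found by computer search: for each pair the second matching becomes, after a
   rotation and the deletion of a quadrilateral, a member of [ring6_component]. *)
Definition bridges : seq (dyck * dyck) :=
  [:: (word "()()(()())()()()", word "(())((())())(())");
      (word "()()(()()()())()", word "(()(()()()()()))");
      (word "()()(()(()())())", word "(())()(()()())()");
      (word "(())()(()()())()", word "()()((()()()()))")].

Definition bridged (d : dyck) : bool :=
  has (fun p => [&& adj d p.1, adj p.1 p.2 & quad_rot p.2]) bridges.

Definition big_test (d : dyck) : bool :=
  [|| d \in ring6_component, quad_rot d |
      has (fun r => bridged (iter r drot d)) (iota 0 16)].

Lemma big_testP d : big_test d -> big d.
Proof.
have offP x : quad_off x -> big x.
  case: x => [|[|a b] v] //.
    by case: v => [|[|? ?] v] //= /big_ring6_component; apply: (@big_quad quadB).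
  by case: a => //; case: b => //= /big_ring6_component; apply: (@big_quad quadA).
have rotP x : quad_rot x -> big x.
  case/hasP=> r _ /offP; apply: big_req; apply: req_sym; by exists r.
have unrot r x : big (iter r drot x) -> big x.
  by apply: big_req; apply: req_sym; exists r.
case/or3P=> [/big_ring6_component //|/rotP //|/hasP[r _ /hasP[[e f] _]]].
case/and3P=> /= h1 h2 /rotP hf; apply: (unrot r); apply: big_conn hf.
by rewrite adjC in h2; rewrite adjC in h1; apply: conn_step h2 (conn1 h1).
Qed.

(** * Small and medium matchings, and the trichotomy *)

(* Two moves turn the octagon with a quadrilateral in one of its gaps into a
   quadrilateral with an octagon in one of its gaps; the other gaps are filled
   with arbitrary matchings. *)
Lemma shift A B C A2 B2 C2 :
  [&& ~~ odd (dsz A), ~~ odd (dsz B), ~~ odd (dsz C),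
      ~~ odd (dsz A2), ~~ odd (dsz B2) & ~~ odd (dsz C2)] ->
  let W := wrap A2 @+ B2 @+ wrap C2 in
  conn (arch (leaf @+ A @+ wrap B @+ C @+ leaf) W)
       (leaf @+ wrap (A @+ wrap B @+ C) @+ leaf @+ W).
Proof.
case/and5P=> /has_nbr[A' hA] /has_nbr[B' hB] /has_nbr[C' hC] /has_nbr[A2' hA2].
case/andP=> /has_nbr[B2' hB2] /has_nbr[C2' hC2] W.
pose Z := wrap (wrap (wrap A' @+ B' @+ wrap C') @+ leaf @+ A2' @+ wrap B2' @+ C2').
apply: (@conn_step _ Z); rewrite /Z /W; first by adj_strip.
by apply: conn1; rewrite adjC; adj_strip.
Qed.

(* An octagon with chains [X] and [Y] hanging from two of its sides, in the only
   two relative positions that occur in medium components. *)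
Definition octT X Y := leaf @+ leaf @+ X @+ leaf @+ wrap Y.
Definition octF X Y := leaf @+ X @+ leaf @+ leaf @+ wrap Y.

Definition med d := exists r ts, conn d (iter r drot (ring 4 @+ achain ts)).

Lemma med_conn x y : conn x y -> med y -> med x.
Proof. by move=> h [r [ts h']]; exists r, ts; apply: conn_trans h'. Qed.

Lemma med_req x y : req x y -> med x -> med y.
Proof.
by case=> s -> [r [ts h]]; exists (s + r), ts; rewrite iterD; apply: conn_iter_rot.
Qed.

Definition good d := med d \/ big d.

Lemma good_conn x y : conn x y -> good y -> good x.
Proof.
by move=> h [/(med_conn h)|/(big_conn (conn_sym h))]; [left|right].
Qed.

Lemma good_req x y : req x y -> good x -> good y.
Proof. by move=> h [/(med_req h)|/(big_req h)]; [left|right]. Qed.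

Lemma med_shift A B C A2 B2 C2 :
  [&& ~~ odd (dsz A), ~~ odd (dsz B), ~~ odd (dsz C),
      ~~ odd (dsz A2), ~~ odd (dsz B2) & ~~ odd (dsz C2)] ->
  let W := wrap A2 @+ B2 @+ wrap C2 in
  med (leaf @+ wrap (A @+ wrap B @+ C) @+ leaf @+ W) ->
  med (leaf @+ A @+ wrap B @+ C @+ leaf @+ wrap W).
Proof.
move=> h W hm.
have e : drot (arch (leaf @+ A @+ wrap B @+ C @+ leaf) W) =
   leaf @+ A @+ wrap B @+ C @+ leaf @+ wrap W by rewrite /W; dnorm; dnorm.
rewrite -e; apply: (med_req (req_rot _)); exact: med_conn (shift h) hm.
Qed.

Lemma med_ring xs : med (ring 4 @+ achain xs).
Proof. by exists 0, xs; apply: conn_refl. Qed.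

Lemma even_achain ts : ~~ odd (dsz (achain ts)).
Proof. by rewrite dsz_achain odd_double. Qed.

Lemma even_bchain ts : ~~ odd (dsz (bchain ts)).
Proof. by rewrite dsz_bchain odd_double. Qed.

(** Each shift transfers one quadrilateral from the chain [ys] to the chain [xs]. Once [ys] is empty
    the octagon stands at the end, and the matching is a rotation of [ring 4] followed by a
    chain. *)
Lemma med_oct xs ys : med (octT (achain xs) (bchain ys)) /\ med (octF (achain xs) (bchain ys)).
Proof.
elim: ys xs => [|y ys IH] xs.
  have h := med_ring xs; split; apply: med_req h; rewrite /octT /octF.
    apply: req_sym; apply: req_trans (req_cat (leaf @+ leaf @+ achain xs) _) _.
    exact: req_refl.
  apply: req_sym; apply: req_trans (req_cat (leaf @+ achain xs) _) _; exact: req_refl.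
split.
  have := @med_shift dnil dnil (achain xs); case: y => /=.
    move/(_ dnil dnil (bchain ys)); rewrite even_achain even_bchain => /(_ isT).
    by apply; exact: (IH (true :: xs)).2.
  move/(_ (bchain ys) dnil dnil); rewrite even_achain even_bchain => /(_ isT).
  by apply; have := med_req (req_cat leaf _) (IH (true :: xs)).1; dnorm.
have := @med_shift (achain xs) dnil dnil; case: y => /=.
  move/(_ dnil dnil (bchain ys)); rewrite even_achain even_bchain => /(_ isT).
  by apply; exact: (IH (false :: xs)).2.
move/(_ (bchain ys) dnil dnil); rewrite even_achain even_bchain => /(_ isT).
by apply; have := med_req (req_cat leaf _) (IH (false :: xs)).1; dnorm.
Qed.

Lemma med_octT_eq xs ys d : octT (achain xs) (bchain ys) = d -> med d.
Proof. by move<-; case: (med_oct xs ys). Qed.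

Lemma med_octF_eq xs ys d : octF (achain xs) (bchain ys) = d -> med d.
Proof. by move<-; case: (med_oct xs ys). Qed.

Lemma big_catC x y : big (y @+ x) -> big (x @+ y).
Proof. exact/big_req/req_cat. Qed.

Lemma med_catC x y : med (y @+ x) -> med (x @+ y).
Proof. exact/med_req/req_cat. Qed.

Lemma med_arch u v : med (v @+ wrap u) -> med (arch u v).
Proof. exact: (@med_catC (wrap u)). Qed.

(** Rotates the goal until the replacement [H] applies at the front; what is left after all chains
    are stripped is closed and falls to [big_by]. In [med_byn] the rotations are bounded by fuel, as
    the shape may be missed. *)
Ltac big_strip H :=
  dnorm; first [apply: H | lazymatch goal with
    | |- big (arch _ _) => apply: big_unrot; big_strip H
    | |- big (_ @+ _) => apply: big_catC; big_strip H end].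
Ltac big_by := dnorm; apply: big_testP; vm_compute; reflexivity.
Ltac med_byn n xs ys :=
  lazymatch n with O => fail 1000 "med_by" | S ?m =>
  dnorm;
  first [apply: (@med_octT_eq xs ys); rewrite /octT; dnorm;
         lazymatch goal with |- ?x = ?x => reflexivity end
        |apply: (@med_octF_eq xs ys); rewrite /octF; dnorm;
         lazymatch goal with |- ?x = ?x => reflexivity end
        |lazymatch goal with
         | |- med (arch _ _) => apply: med_arch; med_byn m xs ys
         | |- med (_ @+ _) => apply: med_catC; med_byn m xs ys end] end.
Ltac med_by xs ys := med_byn 16 xs ys.

(** The first quadrilateral of the chain, with [A], [B], [C] in its gaps, is absorbed into the
    octagon, which releases another one on the side of [ys]. The bit [y] says how [ys] hangs from
    the released one: its two values correspond to [octT] and [octF]. *)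
Lemma good_shift A B C ys :
  [&& ~~ odd (dsz A), ~~ odd (dsz B) & ~~ odd (dsz C)] ->
  (forall y, good (leaf @+ A @+ wrap B @+ C @+ leaf @+ wrap (bchain (y :: ys)))) ->
  good (octT (wrap (A @+ wrap B @+ C)) (bchain ys)) /\
  good (octF (wrap (A @+ wrap B @+ C)) (bchain ys)).
Proof.
case/and3P=> hA hB hC h; have gen A2 C2 : ~~ odd (dsz A2) -> ~~ odd (dsz C2) ->
    good (leaf @+ A @+ wrap B @+ C @+ leaf @+ wrap (wrap A2 @+ wrap C2)) ->
    good (leaf @+ wrap (A @+ wrap B @+ C) @+ leaf @+ wrap A2 @+ wrap C2).
  move=> hA2 hC2 hg; have hs := @shift A B C A2 dnil C2.
  apply: (good_conn (conn_sym (hs _))); first by rewrite hA hB hC hA2 hC2.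
  apply: (good_req (req_sym (req_rot _))); move: hg.
  by congr good; dnorm; dnorm.
split.
  have := gen _ dnil (even_bchain ys) isT (h false).
  exact/good_req/req_sym/(req_cat leaf (leaf @+ wrap _ @+ leaf @+ wrap _)).
exact: gen dnil _ isT (even_bchain ys) (h true).
Qed.

(** If [q] is [quadA] and no other chain is present, [q] starts a chain in an admissible position
    and the matching is medium. In all other cases enough remains after stripping to verify bigness
    by evaluation. *)
Lemma oct_gap1 q xs ys y : quad q ->
  good (leaf @+ q @+ leaf @+ achain xs @+ leaf @+ wrap (bchain (y :: ys))).
Proof.
case/orP=> /eqP->; case: xs => [|x xs].
- by left; exact: (med_oct [:: true] (y :: ys)).2.
- right; big_strip (bigle_acore x xs); big_strip (bigle_bchain (y :: ys)); big_by.
- right; big_strip (bigle_bchain (y :: ys)); big_by.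
- right; big_strip (bigle_achain (x :: xs)); big_strip (bigle_bchain (y :: ys)); big_by.
Qed.

Lemma oct_gap3 q xs ys y : quad q ->
  good (leaf @+ achain xs @+ leaf @+ q @+ leaf @+ wrap (bchain (y :: ys))).
Proof.
case/orP=> /eqP->; case: xs => [|x xs].
- by left; exact: (med_oct [:: true] (y :: ys)).1.
- right; big_strip (bigle_acore x xs); big_strip (bigle_bchain (y :: ys)); big_by.
- right; big_strip (bigle_bchain (y :: ys)); big_by.
- right; big_strip (bigle_achain (x :: xs)); big_strip (bigle_bchain (y :: ys)); big_by.
Qed.

(** Here [q] hangs from the side of the octagon opposite to the one carrying the chain [y :: ys],
    which is neither of the positions [octT] and [octF]. *)
Lemma oct_gap2 q xs zs ys y : quad q ->
  good (leaf @+ achain xs @+ wrap q @+ achain zs @+ leaf @+ wrap (bchain (y :: ys))).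
Proof.
case/orP=> /eqP->; right; big_strip (bigle_achain xs); big_strip (bigle_achain zs).
  by big_strip (bigle_bchain (y :: ys)); big_by.
by big_strip (bigle_bcore y ys); big_by.
Qed.

Lemma oct_side q xs ys : quad q ->
  [/\ good (octT (q @+ achain xs) (bchain ys)), good (octF (q @+ achain xs) (bchain ys)),
      good (octT (achain xs @+ q) (bchain ys)) & good (octF (achain xs @+ q) (bchain ys))].
Proof.
move=> hq; case: xs => [|x xs].
  rewrite dcat0 /=; case/orP: hq => /eqP->.
    have [h1 h2] := med_oct [:: true] ys; split; by left.
  split; right; rewrite /octT /octF; big_strip (bigle_bchain ys); big_by.
by case/orP: hq => /eqP->; split; right; rewrite /octT /octF;
  big_strip (bigle_acore x xs); big_strip (bigle_bchain ys); big_by.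
Qed.

(** A gap deep in the chain is brought next to the octagon by shifting the octagon towards it. Each
    shift shortens [xs] and lengthens [ys], hence the induction on [xs] for all [ys]. *)
Lemma good_oct_ext q xs ys X : quad q -> ext q (achain xs) X ->
  good (octT X (bchain ys)) /\ good (octF X (bchain ys)).
Proof.
move=> hq; elim: xs ys X => [|x xs IH] ys X.
  by move/ext_dnil->; have [h1 h2 _ _] := oct_side [::] ys hq; rewrite dcat0 in h1 h2.
have ev X' : ext q (achain xs) X' -> ~~ odd (dsz X').
  by move/dsz_ext->; rewrite (quad_sz hq) oddD even_achain.
have evq : ~~ odd (dsz q) by rewrite (quad_sz hq).
have [s1 s2 s3 s4] := oct_side (x :: xs) ys hq.
case/ext_arch=> [->|[U hU ->]|[v /ext_dnil-> ->]]; [by split| |by split].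
case: x {s1 s2 s3 s4} hU => hU.
  case/ext_arch: hU => [->|[u /ext_dnil-> ->]|[A hA ->]].
  - apply: (good_shift (A := q) (B := dnil) (C := achain xs)) => [|y].
      by rewrite evq even_achain.
    exact: oct_gap1.
  - apply: (good_shift (A := dnil) (B := q) (C := achain xs)) => [|y].
      by rewrite evq even_achain.
    exact: (oct_gap2 [::]).
  - apply: (good_shift (A := dnil) (B := dnil) (C := A)) => [|y].
      by rewrite (ev _ hA).
    exact: (IH _ _ hA).1.
case/ext_cat: hU => [[A hA ->]|[w hw ->]].
  have := @good_shift A dnil dnil ys; rewrite (ev _ hA); apply=> // y.
  exact: (IH _ _ hA).2.
case/ext_arch: hw => [->|[u /ext_dnil-> ->]|[v /ext_dnil-> ->]].
- rewrite -dcatA; have hA := ext_end q (achain xs).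
  have := @good_shift (achain xs @+ q) dnil dnil ys; rewrite (ev _ hA); apply=> // y.
  exact: (IH _ _ hA).2.
- have := @good_shift (achain xs) q dnil ys; rewrite evq even_achain; apply=> // y.
  exact: (oct_gap2 _ [::]).
- have := @good_shift (achain xs) dnil q ys; rewrite evq even_achain; apply=> // y.
  exact: oct_gap3.
Qed.

Lemma good_ring_ext q xs c : quad q -> ext q (ring 4 @+ achain xs) c -> good c.
Proof.
move=> hq h.
have req_octT X : req (octT X dnil) (ring 4 @+ X).
  exact: (req_cat (leaf @+ leaf @+ X) (leaf @+ leaf)).
move: h; case/ext_arch=> [->|[u /ext_dnil-> ->]|[v hv ->]].
(* Cyclically, the gap before the ring is the gap after the chain. *)
- have [_ _ gX _] := oct_side xs [::] hq.
  exact: good_req (req_trans (req_octT _) (req_cat (ring 4 @+ achain xs) q)) gX.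
- case/orP: hq => /eqP->; [|case: xs => [|x xs]].
  + by right; big_strip (bigle_achain xs); big_by.
  + by left; med_by (Nil bool) [:: true].
  + by right; big_strip (bigle_acore x xs); big_by.
move: hv; case/ext_arch=> [->|[u /ext_dnil-> ->]|[{}v hv ->]].
- case/orP: hq => /eqP->; [case: xs => [|x xs]|].
  + by left; med_by [:: true] (Nil bool).
  + by right; big_strip (bigle_acore x xs); big_by.
  + by right; big_strip (bigle_achain xs); big_by.
- case/orP: hq => /eqP->.
  + by right; big_strip (bigle_achain xs); big_by.
  + by left; med_by xs [:: true].
move: hv; case/ext_arch=> [->|[u /ext_dnil-> ->]|[{}v hv ->]].
- case/orP: hq => /eqP->; [case: xs => [|x xs]|].
  + by left; med_by [:: true] (Nil bool).
  + by right; big_strip (bigle_acore x xs); big_by.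
  + by right; big_strip (bigle_achain xs); big_by.
- case/orP: hq => /eqP->.
  + by right; big_strip (bigle_achain xs); big_by.
  + by left; med_by xs [:: true].
move: hv; case/ext_arch=> [->|[u /ext_dnil-> ->]|[X hX ->]].
- case/orP: hq => /eqP->; [case: xs => [|x xs]|].
  + by left; med_by [:: true] (Nil bool).
  + by right; big_strip (bigle_acore x xs); big_by.
  + by right; big_strip (bigle_achain xs); big_by.
- case/orP: hq => /eqP->; [|case: xs => [|x xs]].
  + by right; big_strip (bigle_achain xs); big_by.
  + by left; med_by (Nil bool) [:: true].
  + by right; big_strip (bigle_acore x xs); big_by.
by apply: good_req (req_octT X) _; exact: (good_oct_ext [::] hq hX).1.
Qed.

(* The small matchings as seen from an arbitrary gap: it faces one
   quadrilateral, which carries at most two chains, on adjacent sides, or it lies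
   between two consecutive quadrilaterals of the chain. *)
Inductive small : dyck -> Prop :=
| small_roofX xs ys : small (wrap (achain xs @+ wrap (bchain ys)))
| small_roofZ ys zs : small (wrap (wrap (bchain ys) @+ achain zs))
| small_floorX xs ys : small (wrap (bchain xs) @+ achain ys @+ leaf)
| small_floorZ ys zs : small (leaf @+ achain ys @+ wrap (bchain zs))
| small_ab xs ys : small (achain xs @+ bchain ys)
| small_ba ys xs : small (bchain ys @+ achain xs).

Lemma small_rot x : small x -> small (drot x).
Proof.
case=> {x} [xs ys|ys zs|xs ys|ys zs|xs ys|ys xs].
- by have := small_ab xs (false :: ys); dnorm.
- by have := small_floorX ys zs; dnorm.
- by have := small_ba xs (false :: ys); dnorm.
- by have := small_roofX ys zs; dnorm.
- case: xs => [|[] xs].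
  + case: ys => [|[] ys]; first exact: (small_ab [::] [::]).
      by have := small_roofZ ys [::]; dnorm.
    by have := small_ba ys [:: true]; dnorm.
  + by have := small_floorZ xs ys; dnorm.
  + by have := small_ab xs (true :: ys); dnorm.
case: ys => [|[] ys].
- case: xs => [|[] xs]; first exact: (small_ab [::] [::]).
    by have := small_floorZ xs [::]; dnorm.
  by have := small_ab xs [:: true]; dnorm.
- by have := small_roofZ ys xs; dnorm.
- by have := small_ba ys (true :: xs); dnorm.
Qed.

Lemma small_req x y : req x y -> small x -> small y.
Proof. by case=> r -> h; elim: r => //= r; apply: small_rot. Qed.

(** Seen from between two quadrilaterals, the matching is a concatenation of two rigid chains,
    possibly empty, so its only neighbour can be read off from this form. *)
Lemma small_req_ab x : small x -> exists xs ys, req x (achain xs @+ bchain ys).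
Proof.
case=> {x} [xs ys|ys zs|xs ys|ys zs|xs ys|ys xs].
- by exists xs, (false :: ys); have := req_rot (wrap (achain xs @+ wrap (bchain ys))); dnorm.
- exists zs, (true :: ys); apply: req_trans (req_rot _) _.
  have := req_cat (wrap (bchain ys) @+ achain zs) leaf; dnorm => /req_trans; apply.
  by have := req_cat (leaf @+ wrap (bchain ys)) (achain zs); dnorm.
- exists ys, (true :: xs).
  have := req_cat (wrap (bchain xs) @+ achain ys) leaf; dnorm => /req_trans; apply.
  by have := req_cat (leaf @+ wrap (bchain xs)) (achain ys); dnorm.
- exists ys, (false :: zs).
  by have := req_cat leaf (achain ys @+ wrap (bchain zs)); dnorm.
- by exists xs, ys; apply: req_refl.
- by exists xs, ys; apply: req_cat.
Qed.

Lemma adj_ab xs ys d : adj (achain xs @+ bchain ys) d -> d = bchain xs @+ achain ys.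
Proof. by case/adj_achain_cat=> d0 -> /adj_bchain->. Qed.

Lemma small_adj x : small x -> exists y, [/\ adj x y, small y & forall z, adj x z -> z = y].
Proof.
case/small_req_ab=> xs [ys /req_sym[r ->]].
exists (iter r drot (bchain xs @+ achain ys)); split.
- by rewrite adj_iter_rot; apply: adj_catI; [|rewrite adjC]; apply: adj_chain.
- by apply: small_req (small_ba xs ys); exists r.
- move=> z; set x0 := (_ @+ _); have [s hs] := rot_iter_inv r x0.
  rewrite -(adj_iter_rot s) hs => /adj_ab h.
  apply: (@iter_rot_inj s); rewrite h; set y0 := _ @+ _.
  have e : adj x0 y0 by apply: adj_catI; [|rewrite adjC]; apply: adj_chain.
  move: e; rewrite -(adj_iter_rot r) -(adj_iter_rot s) hs => /adj_ab ->.
  by rewrite -/y0.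
Qed.

Lemma small_conn x y : conn x y -> small x -> small y.
Proof.
elim=> // {}x {}y z hxy _ IH /small_adj[w [_ hw hu]].
by apply: IH; rewrite (hu _ hxy).
Qed.

Definition trich d := [\/ small d, med d | big d].

Lemma trich_good d : good d -> trich d.
Proof. by case; [apply: Or32|apply: Or33]. Qed.

Lemma trich_conn x y : conn x y -> trich y -> trich x.
Proof.
move=> h [hs|/(med_conn h)|/(big_conn (conn_sym h))]; [|exact: Or32|exact: Or33].
exact/Or31/(small_conn (conn_sym h)).
Qed.

Lemma trich_req x y : req x y -> trich x -> trich y.
Proof.
by move=> h [/(small_req h)|/(med_req h)|/(big_req h)]; [apply: Or31|apply: Or32|apply: Or33].
Qed.

(** All gaps are covered, since the six shapes of [small] describe the matching as seen from any gap
    placed in front. *)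
Lemma trich_quadB_small d : small d -> trich (quadB @+ d).
Proof.
case=> {d} [xs ys|ys zs|xs ys|ys zs|xs ys|ys xs].
- case: ys => [|y ys]; first exact: (Or31 _ _ (small_ba [:: true] (false :: xs))).
  by apply: Or33; big_strip (bigle_achain xs); big_strip (bigle_bcore y ys); big_by.
- case: ys => [|y ys]; first exact: (Or31 _ _ (small_ba [:: true] (true :: zs))).
  by apply: Or33; big_strip (bigle_achain zs); big_strip (bigle_bcore y ys); big_by.
- apply: trich_good; case: ys => [|y ys].
    by left; dnorm; med_by (Nil bool) xs.
  case: xs => [|x xs]; first by left; dnorm; med_by (y :: ys) (Nil bool).
  by right; big_strip (bigle_bcore x xs); big_strip (bigle_acore y ys); big_by.
- apply: trich_good; case: ys => [|y ys].
    by left; dnorm; med_by (Nil bool) zs.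
  case: zs => [|z zs]; first by left; dnorm; med_by (y :: ys) (Nil bool).
  by right; big_strip (bigle_bcore z zs); big_strip (bigle_acore y ys); big_by.
- case: ys => [|[] ys].
  + by rewrite dcat0; apply/Or31/(small_ba [:: true]).
  + by apply: Or32; dnorm; med_by xs ys.
  case: ys => [|y ys]; first by apply: Or32; dnorm; med_by xs (Nil bool).
  case: xs => [|x xs]; first by apply: Or32; dnorm; med_by (Nil bool) (y :: ys).
  by apply: Or33; big_strip (bigle_bcore y ys); big_strip (bigle_acore x xs); big_by.
- case: ys => [|[] ys].
  + by apply/Or31/(small_ba [:: true]).
  + case: ys => [|y ys]; first by apply: Or32; dnorm; med_by xs (Nil bool).
    case: xs => [|x xs]; first by apply: Or32; dnorm; med_by (Nil bool) (y :: ys).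
    by apply: Or33; big_strip (bigle_bcore y ys); big_strip (bigle_acore x xs); big_by.
  + by apply: Or32; dnorm; med_by xs ys.
Qed.

(** A move turns [quadA] into [quadB] and keeps the rest small, so one of the two insertions
    suffices. *)
Lemma trich_quad_small q d : quad q -> small d -> trich (q @+ d).
Proof.
case/orP=> /eqP-> hd; last exact: trich_quadB_small.
have [d' [a hs _]] := small_adj hd.
apply: trich_conn (trich_quadB_small hs); exact/conn1/(adj_catI adj_quad).
Qed.

Lemma trichotomy l d : dsz d = l.+1.*2 -> trich d.
Proof.
elim: l d => [|l IH] d hd.
  have : d \in [:: quadB; quadA] by have := mem_forests d; rewrite hd.
  rewrite !inE => /orP[] /eqP->; apply: Or31.
    exact: (small_ba [:: true] [::]).
  exact: (small_ab [:: true] [::]).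
have [|q [e [hq he /req_sym hr]]] := @req_quad d; first by rewrite hd.
apply: trich_req hr _; case: (IH e) => [|hs|[r [xs h]]|hb].
- by move: hd; rewrite he doubleS => -[].
- exact: trich_quad_small.
- have [q' hq' aq] := quad_adj hq.
  (* The parity of the walk from [e] to the representative is unknown, so both matchings of the
     quadrilateral have to be good there. *)
  have : good (q @+ iter r drot (ring 4 @+ achain xs)) /\
      good (q' @+ iter r drot (ring 4 @+ achain xs)).
    split.
    - have [c h1 h2] := ext_iter_rot q r (ring 4 @+ achain xs).
      exact: good_req (req_sym h2) (good_ring_ext hq h1).
    - have [c h1 h2] := ext_iter_rot q' r (ring 4 @+ achain xs).
      exact: good_req (req_sym h2) (good_ring_ext hq' h1).
  case=> g1 g2; apply: trich_good.
  by case: (conn_lift aq h) => /good_conn; apply.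
- exact/Or33/big_quad.
Qed.

(** * Orders of the big components *)

Lemma dsz_ring n : dsz (ring n) = n.
Proof. by elim: n => //= n ->. Qed.

Lemma ring_cat m n : ring m @+ ring n = ring (m + n).
Proof. by elim: m => //= m ->. Qed.

Lemma edges_ring o n (e : nat * nat) : e \in edges o (ring n) -> e.2 = e.1.+1 /\ ~~ odd (e.1 - o).
Proof.
elim: n o => //= n IH o; rewrite inE addn0 => /orP[/eqP->|h] /=; first by rewrite subnn.
by have [-> h1] := IH _ h; have [h2 _ _ _] := edges_range h; split=> //; lia.
Qed.

(** These are the two alternating matchings of the sides of the hull, the second being a rotation of
    the first; for [n = 1] they would coincide. *)
Lemma adj_ring n : 1 < n -> adj (ring n) (wrap (ring n.-1)).
Proof.
case: n => // n hn; apply/andP; split; first by rewrite /= addn0.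
apply/allrelP => e f /edges_ring[h1 h2]; rewrite /= inE cats0 => /orP[/eqP->|].
  by rewrite /compat /cross -pair_eqE /pair_eq /= dsz_ring; lia.
move=> hf; have [h3 h4] := edges_ring hf; have [h5 _ _ _] := edges_range hf.
by rewrite /compat /cross -pair_eqE /pair_eq /=; lia.
Qed.

Lemma conn_rot_ring n : 1 < n -> conn (drot (ring n)) (ring n).
Proof. by case: n => // n hn; apply: conn1; rewrite adjC; apply: adj_ring. Qed.

Fixpoint walk (x : dyck) (s : seq dyck) : bool :=
  if s is y :: s' then adj x y && walk y s' else true.

Lemma walk_conn x s : walk x s -> conn x (last x s).
Proof.
elim: s x => [|y s IH] x /=; first by move=> _; apply: conn_refl.
by case/andP=> h /IH; apply: conn_step.
Qed.

Lemma walk_conn_cat x s r r' : walk x s -> adj r r' ->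
  conn (x @+ r) (last x s @+ if odd (size s) then r' else r).
Proof.
elim: s x r r' => [|y s IH] x r r' /=; first by move=> *; apply: conn_refl.
case/andP=> h /IH hw hr; have := hw r' r; rewrite adjC => /(_ hr) h'.
apply: conn_step (adj_catI h hr) _; move: h'; by case: (odd _).
Qed.

(* The matchings with 8 edges that are neither small nor medium form two
   components, those of [ring 8] and of [hook8]. *)
Definition hook8 := quadA @+ ring 6.

Lemma conn_rot_hook8 : conn (drot hook8) hook8.
Proof.
apply: (@walk_conn _ [:: word "(()(()())(()()))";
  word "()()(())(()()())"; word "(())()()()()()()"]).
by vm_compute.
Qed.

(** Leads from [quadA @+ ring 8] to [ring 10] in an even number of moves, so a ring appended to it,
    switched at each move, ends unchanged. *)
Definition ring10_walk : seq dyck :=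
  [:: word "()()(())(()()())(())"; word "(()(()())(()()))()()";
      word "(((()()())(()))()())"; word "()()()()()()()()()()"].

Lemma conn_quadA_ring n : ~~ odd n -> conn (quadA @+ ring (8 + n)) (ring (10 + n)).
Proof.
have hw : walk (quadA @+ ring 8) ring10_walk by vm_compute.
case: n => [|[|n]] // hn; first exact: walk_conn hw.
have := walk_conn_cat hw (@adj_ring n.+2 isT).
by rewrite dcatA !ring_cat.
Qed.

Lemma conn_quad_ring q n : quad q -> ~~ odd n -> conn (q @+ ring (8 + n)) (ring (10 + n)).
Proof. by case/orP=> /eqP->; [exact: conn_quadA_ring|move=> _; apply: conn_refl]. Qed.

Lemma conn_quad_hook8 q : quad q -> conn (q @+ hook8) (ring 10).
Proof.
case/orP=> /eqP->.
  apply: (@walk_conn _ [:: word "()()()()(())(())(())"; word "(()()())()()()()()()";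
    word "((()())())(())(()())"; word "()(())()()()()()()()"; word "((()()(())(()()())))";
    word "()(()(()())(()()))()"; word "(()((()()())(()))())"; word "()()()()()()()()()()"]).
  by vm_compute.
apply: (@walk_conn _ [:: word "(())()()(())(()()())"; word "()()(()(()())(()()))";
   word "(()()((()()())(())))"; word "()()()()()()()()()()"]).
by vm_compute.
Qed.

(** Every constructor of [big] preserves this list: a ring and [hook8] are connected to their
    rotations, and a quadrilateral in front lifts through the walk to the representative. From 10
    edges on the two possible results merge. *)
Lemma big_conn_ring d : big d ->
  [\/ dsz d = 6 /\ conn d (ring 6),
      dsz d = 8 /\ (conn d (ring 8) \/ conn d hook8)
    | exists n, [/\ ~~ odd n, dsz d = 10 + n & conn d (ring (10 + n))]].
Proof.
elim=> {d} [|x y h _ IH|x _ IH|q x hq _ IH].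
- by apply: Or31; split=> //; apply: conn_refl.
- have h' := conn_sym h; rewrite -(conn_sz h); case: IH => [[hs hc]|[hs hc]|[n [hn hs hc]]].
  + by apply: Or31; split=> //; apply: conn_trans hc.
  + by apply: Or32; split=> //; case: hc => hc; [left|right]; apply: conn_trans hc.
  + by apply: Or33; exists n; split=> //; apply: conn_trans hc.
- rewrite dsz_rot; case: IH => [[hs hc]|[hs hc]|[n [hn hs hc]]].
  + apply: Or31; split=> //; apply: conn_trans (conn_iter_rot 1 hc) _; exact: conn_rot_ring.
  + apply: Or32; split=> //; case: hc => /(conn_iter_rot 1) hc; [left|right].
      by apply: conn_trans hc _; apply: conn_rot_ring.
    by apply: conn_trans hc _; apply: conn_rot_hook8.
  + by apply: Or33; exists n; split=> //; apply: conn_trans (conn_iter_rot 1 hc) (conn_rot_ring _).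
have [q' hq' aq] := quad_adj hq.
have lift y : conn x y -> exists2 q2, quad q2 & conn (q @+ x) (q2 @+ y).
  by case/(conn_lift aq) => h; [exists q|exists q'].
rewrite dsz_cat (quad_sz hq); case: IH => [[hs /lift[q2 hq2 hc]]|[hs hc]|[n [hn hs /lift[q2 hq2 hc]]]].
- apply: Or32; rewrite hs; split=> //; case/orP: hq2 hc => /eqP-> hc; by [right|left].
- apply: Or33; exists 0; rewrite hs; split=> //.
  case: hc => /lift[q2 hq2 hc]; apply: conn_trans hc _.
    exact: (@conn_quad_ring _ 0).
  exact: conn_quad_hook8.
- apply: Or33; exists n.+2; rewrite hs; split; rewrite ?negbK //.
  by apply: conn_trans hc _; apply: (@conn_quad_ring _ n.+2); rewrite // /= negbK.
Qed.

(** * Lower bounds for the orders of big components *)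

Definition unquad (d : dyck) : dyck :=
  match d with arch dnil (arch _ v) => v | arch _ v => v | dnil => dnil end.

Lemma unquadK q d : quad q -> unquad (q @+ d) = d.
Proof. by case/orP=> /eqP->. Qed.

(** Each vertex lifts with one of the two matchings of the quadrilateral, depending on parity. Since
    [unquad] recovers it in both cases, distinct vertices have distinct lifts. *)
Lemma lift_seq q d s : quad q -> (forall x, x \in s -> conn d x) ->
  exists2 s', map unquad s' = s & forall y, y \in s' -> conn (q @+ d) y.
Proof.
move=> hq; have [q' hq' aq] := quad_adj hq.
elim: s => [|x s IH] h; first by exists [::].
have [|s' es hs'] := IH; first by move=> y hy; apply: h; rewrite inE hy orbT.
have [q2 hq2 hx] : exists2 q2, quad q2 & conn (q @+ d) (q2 @+ x).
  have /(conn_lift aq) [hx|hx] : conn d x by apply: h; rewrite mem_head.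
    by exists q.
  by exists q'.
exists ((q2 @+ x) :: s') => /= [|y]; first by rewrite unquadK // es.
by rewrite inE => /predU1P[->|/hs'].
Qed.

(** The two matchings of each further quadrilateral give disjoint copies of the list, whence the
    factor 2; the start is [ring6_component] with one quadrilateral in front. *)
Lemma big_seq l : exists s, [/\ uniq s, 36 * 2 ^ l <= size s &
  forall x, x \in s -> big x /\ dsz x = 8 + l.*2].
Proof.
have uq q s : quad q -> uniq s -> uniq (map (dcat q) s).
  by move=> hq; rewrite map_inj_uniq // => x y /(congr1 unquad); rewrite !unquadK.
elim: l => [|l [s [us ss hs]]].
  exists (map (dcat quadA) ring6_component); split.
  - by apply: uq => //; vm_compute.
  - by rewrite size_map.
  - move=> x /mapP[y hy ->]; have hb := big_ring6_component hy; split.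
      exact: big_quad.
    rewrite dsz_cat; suff -> : dsz y = 6 by [].
    by apply/eqP/(allP (_ : all (fun y => dsz y == 6) ring6_component) _ hy); vm_compute.
exists (map (dcat quadA) s ++ map (dcat quadB) s); split.
- rewrite cat_uniq !uq // andbT; apply/hasPn => x /mapP[y hy ->].
  by apply/mapP => -[z hz].
- by rewrite size_cat !size_map expnS mulnCA mul2n -addnn leq_add.
- move=> x; rewrite mem_cat => /orP[] /mapP[y /hs[hb hy] ->]; rewrite dsz_cat hy /=;
    split; [exact: (@big_quad quadA)|lia|exact: (@big_quad quadB)|lia].
Qed.

Lemma big_component l d : big d -> dsz d = l.*2 ->
  exists s, [/\ uniq s, 6 * l - 6 < size s & forall x, x \in s -> conn d x].
Proof.
move=> hb hd; have [[hs hc]|[hs hc]|[n [hn hs hc]]] := big_conn_ring hb.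
- exists ring6_component; split; first by vm_compute.
    by rewrite (_ : size _ = 36) //; lia.
  move=> x hx; apply: conn_trans hc _; move: x hx.
  have -> : ring6_component = closure 3 [:: ring 6] by vm_compute.
  apply: mem_closure => [x y h1 h2|x]; first exact: conn_trans h2 h1.
  by rewrite inE => /eqP->; apply: conn_refl.
- have hr x : x \in ring6_component -> conn (ring 6) x.
    have -> : ring6_component = closure 3 [:: ring 6] by vm_compute.
    move: x; apply: mem_closure => [x y h1 h2|x]; first exact: conn_trans h2 h1.
    by rewrite inE => /eqP->; apply: conn_refl.
  have [q hq hdq] : exists2 q, quad q & conn d (q @+ ring 6).
    by case: hc => hc; [exists quadB|exists quadA].
  have [s es hs'] := lift_seq hq hr; exists s; split.
  + by apply: (@map_uniq _ _ unquad); rewrite es; vm_compute.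
  + by rewrite -(size_map unquad) es (_ : size _ = 36) //; lia.
  + by move=> x /hs'; apply: conn_trans.
(* Here 2l = 8 + 2(l - 4), and 36 * 2^(l-4) exceeds 6l - 6. *)
have [s [us ss hs']] := big_seq (l - 4); exists s; split=> //.
  apply: leq_trans ss; have : l - 4 < 2 ^ (l - 4) by apply: ltn_expl.
  by lia.
(* From 10 edges on, all big matchings of one size are connected to the same ring. *)
move=> x /hs'[hx sx]; apply: conn_trans hc _; apply: conn_sym.
have [[h _]|[h _]|[m [_ h1 h2]]] := big_conn_ring hx; try lia.
by have -> : n = m by lia.
Qed.

(** * The medium components *)

Lemma rot_surj r d : exists e, d = iter r drot e.
Proof.
by have [s h] := rot_iter_inv r d; exists (iter s drot d); rewrite -iterD addnC iterD.
Qed.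

Lemma adj_unrot r z d : adj (iter r drot z) d -> exists2 e, d = iter r drot e & adj z e.
Proof. by have [e ->] := rot_surj r d; rewrite adj_iter_rot; exists e. Qed.

(* [stA] and [stB] add one quadrilateral at the far end of the chain of a medium
   matching; a move switches between them. *)
Definition stA (t : bool) z := if t then wrap (leaf @+ z) else wrap (z @+ leaf).
Definition stB (t : bool) z := if t then leaf @+ wrap z else wrap z @+ leaf.

(* The two matchings of the octagon at the end of the chain [X] (resp. [Y]), seen
   from the gap by which the next quadrilateral would hang. *)
Definition hubA (t : bool) X :=
  wrap (if t then leaf @+ leaf @+ X @+ leaf else leaf @+ X @+ leaf @+ leaf).
Definition hubB (t : bool) Y :=
  if t then leaf @+ leaf @+ wrap Y @+ leaf else leaf @+ wrap Y @+ leaf @+ leaf.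

(* The two other regroupings of the octagon into quadrilaterals: [pendA] are
   neighbours of [hubB], [pendB] of [hubA]. *)
Definition pendA (t : bool) X :=
  if t then [:: quadA @+ wrap (X @+ leaf); wrap (wrap (wrap (leaf @+ X)))]
  else [:: wrap (leaf @+ X) @+ quadA; wrap (wrap (wrap (X @+ leaf)))].
Definition pendB (t : bool) Y :=
  if t then [:: wrap (quadA @+ Y) @+ leaf; leaf @+ wrap (wrap (wrap Y))]
  else [:: leaf @+ wrap (Y @+ quadA); wrap (wrap (wrap Y)) @+ leaf].

(** Each position of the octagon along [ts] contributes one hub and two pendants to each of the
    classes [A] and [B], six vertices in all. Every move exchanges the two classes. *)
Fixpoint hubsA (ts : seq bool) : seq dyck :=
  if ts is t :: ts' then hubA t (achain ts') :: map (stA t) (hubsA ts') else [::].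
Fixpoint hubsB (ts : seq bool) : seq dyck :=
  if ts is t :: ts' then hubB t (bchain ts') :: map (stB t) (hubsB ts') else [::].
Fixpoint pendsA (ts : seq bool) : seq dyck :=
  if ts is t :: ts' then pendA t (achain ts') ++ map (stA t) (pendsA ts') else [::].
Fixpoint pendsB (ts : seq bool) : seq dyck :=
  if ts is t :: ts' then pendB t (bchain ts') ++ map (stB t) (pendsB ts') else [::].

Lemma hubsA_cons t ts : hubsA (t :: ts) = hubA t (achain ts) :: map (stA t) (hubsA ts).
Proof. by []. Qed.

Lemma hubsB_cons t ts : hubsB (t :: ts) = hubB t (bchain ts) :: map (stB t) (hubsB ts).
Proof. by []. Qed.

Lemma pendsA_cons t ts : pendsA (t :: ts) = pendA t (achain ts) ++ map (stA t) (pendsA ts).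
Proof. by []. Qed.

Lemma pendsB_cons t ts : pendsB (t :: ts) = pendB t (bchain ts) ++ map (stB t) (pendsB ts).
Proof. by []. Qed.

Lemma adj_st t x y : adj x y -> adj (stA t x) (stB t y).
Proof. by move=> h; case: t; rewrite /stA /stB; adj_strip. Qed.

Lemma adj_hub t ts : adj (hubA t (achain ts)) (hubB t (bchain ts)).
Proof. by have h := adj_chain ts; case: t; rewrite /hubA /hubB; adj_strip. Qed.

Lemma adj_pendA t ts z : z \in pendA t (achain ts) -> adj (hubB t (bchain ts)) z.
Proof.
have := adj_chain ts; rewrite adjC => h.
by case: t; rewrite !inE => /orP[] /eqP->; rewrite /hubB; adj_strip.
Qed.

Lemma adj_pendB t ts z : z \in pendB t (bchain ts) -> adj (hubA t (achain ts)) z.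
Proof.
have h := adj_chain ts.
by case: t; rewrite !inE => /orP[] /eqP->; rewrite /hubA; adj_strip.
Qed.

(* The number of rotations after which the chain in [hubA] comes first. *)
Definition hub_turn (t : bool) := if t then 5 else 3.

(** With the rigid chain rotated to the front, only the neighbours of [ring 4] remain, and these are
    enumerated. *)
Lemma hubA_nbr t ts d : adj (hubA t (achain ts)) d ->
  d \in hubB t (bchain ts) :: pendB t (bchain ts).
Proof.
rewrite -(adj_iter_rot (hub_turn t)).
have -> : iter (hub_turn t) drot (hubA t (achain ts)) = achain ts @+ ring 4.
  by case: t; rewrite /hubA; dnorm.
case/adj_achain_cat=> d0 hd; rewrite -mem_nbrs => hd0.
rewrite -(mem_map (@iter_rot_inj (hub_turn t))) hd.
have : d0 \in [:: word "(()()())"; word "(())(())"; word "(((())))"].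
  by move: d0 hd0 {hd}; apply/allP; vm_compute.
have -> : map (iter (hub_turn t) drot) (hubB t (bchain ts) :: pendB t (bchain ts)) =
  map (dcat (bchain ts)) (if t then [:: word "(()()())"; word "(())(())"; word "(((())))"]
      else [:: word "(()()())"; word "(())(())"; word "(((())))"]).
  by case: t {hd}; rewrite /hubB /pendB /map; dnorm.
by case: t {hd} => h; rewrite mem_map // => x y /dcat_inj[].
Qed.

(** Up to rotation a pendant is a concatenation of two chains, and rigidity leaves a single move. *)
Lemma pendA_nbr t ts z d : z \in pendA t (achain ts) -> adj z d -> d = hubB t (bchain ts).
Proof.
case: t; rewrite !inE => /orP[] /eqP->.
- have := @adj_achain_cat [:: true] (achain (false :: ts)) d.
  by dnorm => h /h[d0 ->]; move/(@adj_achain (false :: ts))->; dnorm.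
- rewrite -(adj_iter_rot 2) => h; apply: (@iter_rot_inj 2); move: h.
  have := @adj_achain_cat (true :: ts) quadA (iter 2 drot d).
  by dnorm => h /h[d0 ->]; move/(@adj_achain [:: true])->; dnorm.
- have := @adj_achain_cat (true :: ts) (achain [:: true]) d.
  by dnorm => h /h[d0 ->]; move/(@adj_achain [:: true])->; dnorm.
- rewrite -(adj_iter_rot 2) => h; apply: (@iter_rot_inj 2); move: h.
  have := @adj_achain_cat (false :: ts) quadA (iter 2 drot d).
  by dnorm => h /h[d0 ->]; move/(@adj_achain [:: true])->; dnorm.
Qed.

Lemma adj_ba ts us d : adj (bchain ts @+ achain us) d -> d = achain ts @+ bchain us.
Proof.
rewrite -(adj_iter_rot (dsz (bchain ts)).*2) rot_cat => /adj_ab h.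
apply: (@iter_rot_inj (dsz (bchain ts)).*2); rewrite h.
by rewrite -(adj_sz (adj_chain ts)) rot_cat.
Qed.

Lemma pendB_nbr t ts z d : z \in pendB t (bchain ts) -> adj z d -> d = hubA t (achain ts).
Proof.
case: t; rewrite !inE => /orP[] /eqP->.
- rewrite -(adj_iter_rot 1) => h; apply: (@iter_rot_inj 1); move: h.
  have := @adj_achain_cat [:: true] (bchain ts @+ quadA) (iter 1 drot d).
  by rewrite /hubA; dnorm => h /h[d0 ->]; move/(@adj_ba ts [:: true])->; dnorm.
- have -> : leaf @+ wrap (wrap (wrap (bchain ts))) =
      iter 1 drot (achain [:: true] @+ wrap (wrap (bchain ts))) by dnorm.
  case/adj_unrot=> e -> /adj_achain_cat[e0 ->].
  rewrite -(adj_iter_rot 2) => h.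
  have -> : e0 = leaf @+ achain ts @+ leaf.
    apply: (@iter_rot_inj 2); move: h; dnorm.
    by move/(@adj_ba ts [:: true])->; dnorm.
  by rewrite /hubA; dnorm.
- have -> : leaf @+ wrap (bchain ts @+ quadA) =
      iter 1 drot (achain [:: true] @+ bchain ts @+ quadA) by dnorm.
  by case/adj_unrot=> e -> /adj_achain_cat[e0 ->] /(@adj_ba ts [:: true]) ->; rewrite /hubA; dnorm.
- have -> : wrap (wrap (wrap (bchain ts))) @+ leaf =
      iter 3 drot (achain [:: true] @+ wrap (wrap (bchain ts))) by dnorm.
  case/adj_unrot=> e -> /adj_achain_cat[e0 ->].
  rewrite -(adj_iter_rot 2) => h.
  have -> : e0 = leaf @+ achain ts @+ leaf.
    apply: (@iter_rot_inj 2); move: h; dnorm.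
    by move/(@adj_ba ts [:: true])->; dnorm.
  by rewrite /hubA; dnorm.
Qed.

Definition step_turn (t : bool) := if t then 3 else 1.

Lemma stA_turn t z : iter (step_turn t) drot (stA t z) = z @+ quadB.
Proof. by case: t; rewrite /stA; dnorm. Qed.

Lemma stB_turn t z : iter (step_turn t) drot (stB t z) = z @+ quadA.
Proof. by case: t; rewrite /stB; dnorm. Qed.

Lemma adj_cat_quadA z d : adj (z @+ quadA) d -> exists2 e, d = e @+ quadB & adj z e.
Proof.
rewrite -(adj_iter_rot (dsz z).*2) rot_cat.
case/(@adj_achain_cat [:: true])=> e hd h; exists e => //.
by apply: (@iter_rot_inj (dsz z).*2); rewrite hd (adj_sz h) rot_cat.
Qed.

Lemma stB_nbr t z d : adj (stB t z) d -> exists2 e, d = stA t e & adj z e.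
Proof.
rewrite -(adj_iter_rot (step_turn t)) stB_turn => /adj_cat_quadA[e hd h].
by exists e => //; apply: (@iter_rot_inj (step_turn t)); rewrite stA_turn.
Qed.

Lemma adj_ring3 d : adj (ring 3) d -> d = wrap (ring 2).
Proof. by rewrite -mem_nbrs inE => /eqP. Qed.

(** A chain under one additional edge moves according to a position along it: either the first
    quadrilateral joins that edge in a hexagon, or it moves by itself and the same question arises
    for the rest of the chain. *)
Lemma wrap_bchain_nbr ts w : adj (wrap (bchain ts)) w -> wrap w \in hubsA ts.
Proof.
elim: ts w => [|t ts IH] w; first by rewrite adj_leaf.
rewrite -(adj_iter_rot (step_turn t)).
have -> : iter (step_turn t) drot (wrap (bchain (t :: ts))) = arch (bchain ts) (ring 2).
  by case: t; dnorm.
case/adj_split=> [[w' [v [hw /IH h1 h2]]]|[u [a [b [hw /adj_bchain hu hab]]]]].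
  rewrite inE; apply/orP; right; apply/mapP; exists (wrap w') => //.
  have -> : w = stB t w'.
    by apply: (@iter_rot_inj (step_turn t)); rewrite hw stB_turn (adj_quadB h2).
  by case: (t).
rewrite inE; apply/orP; left; apply/eqP; congr wrap.
case: (adj_ring3 hab) hw => -> ->; rewrite hu => hw.
by apply: (@iter_rot_inj (step_turn t)); rewrite hw; case: (t); dnorm.
Qed.

Lemma hubsA_nbr ts z : z \in hubsA ts ->
  exists2 w, z = wrap w & forall d, adj w d <-> d = wrap (bchain ts).
Proof.
elim: ts z => // t ts IH z; rewrite inE => /predU1P[->|/mapP[z' /IH[w' -> hw'] ->]].
  eexists; first by [].
  have ht w : (if t then leaf @+ leaf @+ achain ts @+ leaf
       else leaf @+ achain ts @+ leaf @+ leaf) = w ->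
     iter (hub_turn t).-1 drot w = achain ts @+ ring 3.
    by move<-; case: (t); dnorm.
  have hB : iter (hub_turn t).-1 drot (wrap (bchain (t :: ts))) = bchain ts @+ wrap (ring 2).
    by case: (t); dnorm.
  move=> d; rewrite -(adj_iter_rot (hub_turn t).-1) (ht _ erefl); split.
    case/adj_achain_cat=> d0 hd /adj_ring3 e.
    by apply: (@iter_rot_inj (hub_turn t).-1); rewrite hd e hB.
  by move=> ->; rewrite hB; apply: adj_catI => //; apply: adj_chain.
exists (if t then leaf @+ wrap w' else wrap w' @+ leaf); first by case: (t).
have hr : iter (step_turn t) drot (if t then leaf @+ wrap w' else wrap w' @+ leaf) = w' @+ quadA.
  by case: (t); dnorm.
have hB : iter (step_turn t) drot (wrap (bchain (t :: ts))) = wrap (bchain ts) @+ quadB.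
  by case: (t); dnorm.
move=> d; rewrite -(adj_iter_rot (step_turn t)) hr; split.
  case/adj_cat_quadA=> e hd /hw' he; apply: (@iter_rot_inj (step_turn t)).
  by rewrite hd he hB.
by move=> ->; rewrite hB; apply: adj_catI => //; apply/hw'.
Qed.

Lemma hubA_head t ts : hubA t (achain ts) \in hubsA (t :: ts).
Proof. exact: mem_head. Qed.

Lemma wrap_nbr_quadB p d : adj (wrap p @+ quadB) d ->
  (exists2 e, d = e @+ quadA & adj (wrap p) e) \/
  (exists2 p', d = wrap (p' @+ quadB) & adj p p').
Proof.
case/adj_split=> [[e [v [-> h1 /adj_quadB->]]]|[p' [a [b [-> h1 h2]]]]].
  by left; exists e.
by right; exists p' => //; have [-> ->] := adj_ring3 h2.
Qed.

Lemma wrap_nbr_leaf p d : adj (wrap p @+ leaf) d ->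
  exists2 p', d = wrap (p' @+ leaf) & adj p p'.
Proof.
case/adj_split=> [[e [v [_ _]]]|[p' [a [b [-> h1 h2]]]]]; first by rewrite adj_leaf.
by exists p' => //; have [-> ->] := adj_quadB h2.
Qed.

(* Ensures that a pendant vertex [z] remains pendant after [stA]. *)
Definition inert z := [/\ forall d, ~~ adj (z @+ leaf) d &
  forall d, adj (z @+ quadB) d -> exists2 e, d = e @+ quadA & adj z e].

Lemma inert_wrap p : (forall d, ~~ adj p d) -> inert (wrap p).
Proof.
move=> h; split=> d.
  by apply/negP => /wrap_nbr_leaf[p' _]; rewrite (negPf (h _)).
by case/wrap_nbr_quadB=> // -[p' _]; rewrite (negPf (h _)).
Qed.

Lemma inert_chains xs ys : inert (achain xs @+ achain ys).
Proof.
split=> d; rewrite dcatA.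
  by apply/negP => /adj_achain_cat[e _ /adj_achain_cat[e' _]]; rewrite adj_leaf.
case/adj_achain_cat=> e -> /adj_achain_cat[e' -> /adj_quadB ->].
by exists (bchain xs @+ bchain ys); [rewrite dcatA|apply: adj_catI; apply: adj_chain].
Qed.

Lemma inert_st t z : inert z -> inert (stA t z).
Proof.
case=> h _; have hz d : ~~ adj (leaf @+ z) d.
  by rewrite -(adj_iter_rot 2) (rot_cat leaf) h.
by case: t; rewrite /stA; apply: inert_wrap.
Qed.

Lemma pendsA_inert ts z : z \in pendsA ts -> inert z.
Proof.
elim: ts z => // t ts IH z; rewrite mem_cat => /orP[|/mapP[z' /IH h ->]]; last exact: inert_st.
have hA us d : ~~ adj (wrap (achain us)) d.
  by rewrite -adj_rot; apply/negP => /= /adj_achain_cat[e _]; rewrite adj_leaf.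
case: t; rewrite !inE => /orP[] /eqP->.
- exact: (inert_chains [:: true] (false :: ts)).
- exact/inert_wrap/(hA (true :: ts)).
- exact: (inert_chains (true :: ts) [:: true]).
- exact/inert_wrap/(hA (false :: ts)).
Qed.

Lemma stA_inert_nbr t z d : inert z -> adj (stA t z) d -> exists2 e, d = stB t e & adj z e.
Proof.
case=> _ h; rewrite -(adj_iter_rot (step_turn t)) stA_turn => /h[e hd hz].
by exists e => //; apply: (@iter_rot_inj (step_turn t)); rewrite stB_turn.
Qed.

Lemma stA_hub_nbr t ts z d : z \in hubsA ts -> adj (stA t z) d ->
  d = hubB t (bchain ts) \/ exists2 e, d = stB t e & adj z e.
Proof.
case/hubsA_nbr=> w -> hw.
rewrite -(adj_iter_rot (step_turn t)) stA_turn => /wrap_nbr_quadB[[e hd he]|[p hd /hw hp]].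
  by right; exists e => //; apply: (@iter_rot_inj (step_turn t)); rewrite stB_turn.
left; apply: (@iter_rot_inj (step_turn t)); rewrite hd hp /hubB.
by case: (t); dnorm.
Qed.

(** After a rotation the chain lies under the first edge. If it moves by itself, the rest is a
    neighbour of [ring 4]; if it moves together with that edge, the octagon reappears at some later
    position of the chain. *)
Lemma hubB_nbr t ts d : adj (hubB t (bchain ts)) d ->
  [\/ d = hubA t (achain ts), d \in pendA t (achain ts) |
      exists2 z, d = stA t z & z \in hubsA ts].
Proof.
pose r := if t then 4 else 2.
rewrite -(adj_iter_rot r).
have -> : iter r drot (hubB t (bchain ts)) = arch (bchain ts) (ring 3).
  by rewrite /r /hubB; case: (t); dnorm.
case/adj_split=> [[w [v [hd /wrap_bchain_nbr hw /adj_ring3 hv]]]|[u [a [b [hd /adj_bchain hu hab]]]]].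
  apply: Or33; exists (wrap w) => //; apply: (@iter_rot_inj r).
  by rewrite hd hv /stA /r; case: (t); dnorm.
have : d \in hubA t (achain ts) :: pendA t (achain ts).
  rewrite -(mem_map (@iter_rot_inj r)) hd hu.
  have : arch a b \in nbrs (ring 4) by rewrite mem_nbrs.
  rewrite [nbrs _](_ : _ = [:: word "(())(())"; word "(()()())"; word "(((())))"]) //.
  by rewrite !inE => /or3P[] /eqP[-> ->]; rewrite /r /hubA; case: (t); dnorm; rewrite !inE eqxx ?orbT.
by rewrite inE => /predU1P[->|h]; [apply: Or31|apply: Or32].
Qed.

Definition octagon_component ts :=
  (hubsA ts ++ pendsA ts) ++ (hubsB ts ++ pendsB ts).

Lemma octagon_closed_A ts z d : z \in hubsA ts ++ pendsA ts -> adj z d ->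
  d \in hubsB ts ++ pendsB ts.
Proof.
elim: ts z d => // t ts IH z d; rewrite mem_cat [d \in _]mem_cat.
have lift z' d' : z' \in hubsA ts ++ pendsA ts -> adj z' d' ->
    (stB t d' \in hubsB (t :: ts)) || (stB t d' \in pendsB (t :: ts)).
  move=> h1 h2; have := IH _ _ h1 h2; rewrite mem_cat => /orP[h|h].
    by rewrite inE map_f ?orbT.
  by rewrite ?pendsA_cons ?pendsB_cons [X in _ || X]mem_cat map_f ?orbT.
case/orP; first rewrite inE => /predU1P[->|/mapP[z' hz ->]].
- move/hubA_nbr; rewrite !inE => /predU1P[->|h]; first by rewrite eqxx.
  by rewrite pendsB_cons mem_cat h !orbT.
- case/(stA_hub_nbr hz) => [->|[e -> he]]; first by rewrite mem_head.
  by apply: lift he; rewrite mem_cat hz.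
rewrite ?pendsA_cons ?pendsB_cons mem_cat => /orP[hz /(pendA_nbr hz)->|/mapP[z' hz ->]];
  first by rewrite mem_head.
case/(stA_inert_nbr (pendsA_inert hz)) => e -> he.
by apply: lift he; rewrite mem_cat hz orbT.
Qed.

Lemma octagon_closed_B ts z d : z \in hubsB ts ++ pendsB ts -> adj z d ->
  d \in hubsA ts ++ pendsA ts.
Proof.
elim: ts z d => // t ts IH z d; rewrite mem_cat [d \in _]mem_cat.
have lift z' d' : z' \in hubsB ts ++ pendsB ts -> adj z' d' ->
    (stA t d' \in hubsA (t :: ts)) || (stA t d' \in pendsA (t :: ts)).
  move=> h1 h2; have := IH _ _ h1 h2; rewrite mem_cat => /orP[h|h].
    by rewrite inE map_f ?orbT.
  by rewrite ?pendsA_cons ?pendsB_cons [X in _ || X]mem_cat map_f ?orbT.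
case/orP; first rewrite inE => /predU1P[->|/mapP[z' hz ->]].
- case/hubB_nbr=> [->|h|[z' -> hz]]; first by rewrite mem_head.
    by rewrite pendsA_cons [X in _ || X]mem_cat h orbT.
  by rewrite inE map_f ?orbT.
- by case/stB_nbr=> e -> he; apply: lift he; rewrite mem_cat hz.
rewrite ?pendsA_cons ?pendsB_cons mem_cat => /orP[hz /(pendB_nbr hz)->|/mapP[z' hz ->]];
  first by rewrite mem_head.
by case/stB_nbr=> e -> he; apply: lift he; rewrite mem_cat hz orbT.
Qed.

Lemma octagon_closed ts z d : z \in octagon_component ts -> adj z d ->
  d \in octagon_component ts.
Proof.
rewrite [z \in _]mem_cat [d \in _]mem_cat =>
  /orP[h /(octagon_closed_A h)->|h /(octagon_closed_B h)->] //.
by rewrite orbT.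
Qed.

Lemma octagon_closed_conn ts z d : z \in octagon_component ts -> conn z d ->
  d \in octagon_component ts.
Proof. by move=> hz h; elim: h hz => // x y w hxy _ IH hx; apply/IH/(octagon_closed hx). Qed.

(* Walks of even length, which [stA] and [stB] preserve. *)
Inductive conn2 : dyck -> dyck -> Prop :=
| conn2_refl x : conn2 x x
| conn2_step x y z w : adj x y -> adj y z -> conn2 z w -> conn2 x w.

Lemma conn2_conn x y : conn2 x y -> conn x y.
Proof.
elim=> [z|{}x {}y z w h1 h2 _ h]; first exact: conn_refl.
exact: conn_step h1 (conn_step h2 h).
Qed.

Lemma conn2_st t x y : conn2 x y -> conn2 (stA t x) (stA t y) /\ conn2 (stB t x) (stB t y).
Proof.
elim=> [z|{}x {}y z w h1 h2 _ [IH1 IH2]]; first by split; apply: conn2_refl.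
have adj_st' a b : adj a b -> adj (stB t a) (stA t b).
  by rewrite adjC => h; rewrite adjC; apply: adj_st.
split; first exact: conn2_step (adj_st t h1) (adj_st' _ _ h2) IH1.
exact: conn2_step (adj_st' _ _ h1) (adj_st t h2) IH2.
Qed.

Lemma adj_hubs_st t ts z : z \in hubsA ts -> adj (stA t z) (hubB t (bchain ts)).
Proof.
case/hubsA_nbr=> w -> hw.
have gen W : adj W w -> adj (if t then leaf @+ leaf @+ W @+ leaf
    else leaf @+ W @+ leaf @+ leaf) (stA t (wrap w)).
  by rewrite /stA; case: (t) => h; adj_strip.
by rewrite adjC; apply: gen; rewrite adjC; apply/hw.
Qed.

(** Since [hubB] is adjacent to the hub at the next position, it remains to lift the even walks of
    the shorter chain by [stA] and [stB]. *)
Lemma octagon_conn2 t ts :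
  (forall z, z \in hubsA (t :: ts) ++ pendsA (t :: ts) -> conn2 (hubA t (achain ts)) z) /\
  (forall z, z \in hubsB (t :: ts) ++ pendsB (t :: ts) -> conn2 (hubB t (bchain ts)) z).
Proof.
elim: ts t => [|t' ts IH] t.
  split=> z; rewrite mem_cat ?pendsA_cons ?pendsB_cons !cats0 inE => /orP[/eqP->|h]; try exact: conn2_refl.
    exact: conn2_step (adj_hub t [::]) (@adj_pendA t [::] _ h) (conn2_refl _).
  by apply: conn2_step (@adj_pendB t [::] _ h) (conn2_refl _); rewrite adjC (adj_hub t [::]).
have [IHA IHB] := IH t'.
have hA := adj_hub t (t' :: ts).
have hs : adj (hubB t (bchain (t' :: ts))) (stA t (hubA t' (achain ts))).
  by rewrite adjC adj_hubs_st ?hubA_head.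
have hst : adj (stA t (hubA t' (achain ts))) (stB t (hubB t' (bchain ts))).
  exact/adj_st/adj_hub.
split=> z; rewrite mem_cat => /orP[].
- rewrite hubsA_cons in_cons => /predU1P[->|/mapP[z' hz ->]]; first exact: conn2_refl.
  apply: conn2_step hA hs _; apply: (conn2_st t _).1; apply: IHA.
  by rewrite mem_cat hz.
- rewrite pendsA_cons mem_cat => /orP[h|/mapP[z' hz ->]].
    exact: conn2_step hA (adj_pendA h) (conn2_refl _).
  apply: conn2_step hA hs _; apply: (conn2_st t _).1; apply: IHA.
  by rewrite mem_cat hz orbT.
- rewrite hubsB_cons in_cons => /predU1P[->|/mapP[z' hz ->]]; first exact: conn2_refl.
  apply: conn2_step hs hst _; apply: (conn2_st t _).2; apply: IHB.
  by rewrite mem_cat hz.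
- rewrite pendsB_cons mem_cat => /orP[h|/mapP[z' hz ->]].
    by apply: conn2_step (adj_pendB h) (conn2_refl _); rewrite adjC.
  apply: conn2_step hs hst _; apply: (conn2_st t _).2; apply: IHB.
  by rewrite mem_cat hz orbT.
Qed.

Lemma octagon_conn t ts z : z \in octagon_component (t :: ts) -> conn (hubA t (achain ts)) z.
Proof.
have [hA hB] := octagon_conn2 t ts; rewrite mem_cat => /orP[/hA/conn2_conn //|/hB/conn2_conn].
exact: conn_step (adj_hub t ts).
Qed.

Lemma size_octagon_component ts : size (octagon_component ts) = 6 * size ts.
Proof.
rewrite !size_cat; elim: ts => // t ts; rewrite /= !size_cat !size_map.
by case: t => /=; lia.
Qed.

(** * Distinctness of the listed vertices *)

Fixpoint topleaf (d : dyck) : bool :=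
  if d is arch u v then (u == dnil) || topleaf v else false.

Definition multi (d : dyck) : bool :=
  if d is arch _ (arch _ _) then true else false.

Lemma topleaf_cat x y : topleaf (x @+ y) = topleaf x || topleaf y.
Proof. by elim: x => //= u _ v ->; rewrite orbA. Qed.

Lemma dcat_injr x x' y : x @+ y = x' @+ y -> x = x'.
Proof.
move=> h; have hs : dsz x = dsz x' by have := congr1 dsz h; rewrite !dsz_cat; lia.
by have [] := dcat_inj hs h.
Qed.

Lemma stA_inj t : injective (stA t).
Proof.
by move=> x y /(congr1 (iter (step_turn t) drot)); rewrite !stA_turn => /dcat_injr.
Qed.

Lemma stB_inj t : injective (stB t).
Proof.
by move=> x y /(congr1 (iter (step_turn t) drot)); rewrite !stB_turn => /dcat_injr.
Qed.

Lemma cat_leaf_neq x : x @+ leaf <> dnil.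
Proof. by case: x. Qed.

(** Together with [topleaf_B] this separates the classes [A] and [B], and it also distinguishes a
    new octagon from a vertex obtained by [stA]. *)
Lemma topleaf_A ts z : z \in hubsA ts ++ pendsA ts -> topleaf z = false.
Proof.
have hw x : x <> dnil -> topleaf (wrap x) = false by case: x.
have hs t y : topleaf (stA t y) = false.
  by case: t => //; apply/hw/cat_leaf_neq.
case: ts => // t ts; rewrite mem_cat => /orP[].
  rewrite hubsA_cons in_cons => /predU1P[->|/mapP[y _ ->]]; last exact: hs.
  by case: t.
rewrite pendsA_cons mem_cat => /orP[|/mapP[y _ ->]]; last exact: hs.
by case: t; rewrite !inE => /orP[] /eqP-> //; rewrite /= ?orbF; case: (achain ts).
Qed.

Lemma topleaf_B ts z : z \in hubsB ts ++ pendsB ts -> topleaf z.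
Proof.
have hs t y : topleaf (stB t y) by case: t => //=; rewrite orbT.
case: ts => // t ts; rewrite mem_cat => /orP[].
  rewrite hubsB_cons in_cons => /predU1P[->|/mapP[y _ ->]]; last exact: hs.
  by case: t.
rewrite pendsB_cons mem_cat => /orP[|/mapP[y _ ->]]; last exact: hs.
by case: t; rewrite !inE => /orP[] /eqP->; rewrite /= ?orbT.
Qed.

Lemma multi_B ts z : z \in hubsB ts ++ pendsB ts -> multi z.
Proof.
have hs t y : multi (stB t y) by case: t.
case: ts => // t ts; rewrite mem_cat => /orP[].
  rewrite hubsB_cons in_cons => /predU1P[->|/mapP[y _ ->]]; last exact: hs.
  by case: t.
rewrite pendsB_cons mem_cat => /orP[|/mapP[y _ ->]]; last exact: hs.
by case: t; rewrite !inE => /orP[] /eqP->.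
Qed.

Lemma hubA_pendA_uniq t X : uniq (hubA t X :: pendA t X).
Proof.
by case: t => //=; rewrite andbT; apply/negP; rewrite !inE => /orP[] /eqP; case.
Qed.

Lemma hubB_pendB_uniq t Y : uniq (hubB t Y :: pendB t Y).
Proof.
by case: t => //=; rewrite andbT; apply/negP; rewrite !inE => /orP[] /eqP; case.
Qed.

Lemma octagonA_new t ts z x : z \in hubsA ts ++ pendsA ts ->
  x \in hubA t (achain ts) :: pendA t (achain ts) -> x <> stA t z.
Proof.
move/topleaf_A => hz; case: t; rewrite !inE => /or3P[] /eqP-> e.
- by case: e hz => <-.
- by case: e.
- by case: e.
- have : leaf @+ achain ts @+ leaf = z.
    by case: e => e; apply: (@dcat_injr _ _ leaf); rewrite -e /= dcatA.
  by move=> e'; move: hz; rewrite -e'.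
- by case: e.
- case: e => /(congr1 topleaf); rewrite topleaf_cat orbT.
  by case: (achain ts).
Qed.

Lemma hubB_neq_stB t Y z : hubB t Y <> stB t z.
Proof. by case: t. Qed.

Lemma octagonB_new t ts z x : z \in hubsB ts ++ pendsB ts ->
  x \in hubB t (bchain ts) :: pendB t (bchain ts) -> x <> stB t z.
Proof.
move/multi_B => hz; case: t; rewrite !inE => /or3P[] /eqP-> e.
- exact: hubB_neq_stB e.
- by case: e.
- by case: e hz => <-.
- exact: hubB_neq_stB e.
- case: e => _ /(congr1 dsz); by rewrite dsz_cat /= addnC.
- by case: e hz => <-.
Qed.

Lemma uniq_step (h : dyck) p m1 m2 (f : dyck -> dyck) :
  injective f -> uniq (h :: p) -> uniq (m1 ++ m2) ->
  (forall z x, z \in m1 ++ m2 -> x \in h :: p -> x <> f z) ->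
  uniq ((h :: map f m1) ++ (p ++ map f m2)).
Proof.
move=> fi up um hn.
rewrite (perm_uniq (_ : perm_eq _ ((h :: p) ++ map f (m1 ++ m2)))); last first.
  by rewrite map_cat /= perm_cons perm_catCA.
rewrite cat_uniq up map_inj_uniq // um andbT /=; apply/hasPn => _ /mapP[z hz ->].
by apply/negP => h'; case: (hn z _ hz h').
Qed.

Lemma octagonA_uniq ts : uniq (hubsA ts ++ pendsA ts).
Proof.
elim: ts => // t ts IH; apply: uniq_step (@stA_inj t) (hubA_pendA_uniq _ _) IH _.
exact: octagonA_new.
Qed.

Lemma octagonB_uniq ts : uniq (hubsB ts ++ pendsB ts).
Proof.
elim: ts => // t ts IH; apply: uniq_step (@stB_inj t) (hubB_pendB_uniq _ _) IH _.
exact: octagonB_new.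
Qed.

Lemma octagon_component_uniq ts : uniq (octagon_component ts).
Proof.
rewrite cat_uniq octagonA_uniq octagonB_uniq andbT; apply/hasPn => z /topleaf_B hz.
by apply/negP => /topleaf_A; rewrite hz.
Qed.

(** * Recognition of ring chains by their degrees *)

Definition nbrs_ge n z := exists ds, [/\ uniq ds, n <= size ds & all (adj z) ds].

Lemma hubA_nbrs t ts : all (adj (hubA t (achain ts))) (hubB t (bchain ts) :: pendB t (bchain ts)).
Proof.
apply/allP => d; rewrite in_cons => /predU1P[->|]; first exact: adj_hub.
exact: adj_pendB.
Qed.

Lemma hubB_nbrs t ts : all (adj (hubB t (bchain ts))) (hubA t (achain ts) :: pendA t (achain ts)).
Proof.
apply/allP => d; rewrite in_cons => /predU1P[->|]; first by rewrite adjC adj_hub.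
exact: adj_pendA.
Qed.

Lemma nbrs_ge_map n z z' f : injective f -> (forall d, adj z d -> adj z' (f d)) ->
  nbrs_ge n z -> nbrs_ge n z'.
Proof.
move=> fi hf [ds [ud sd /allP ad]]; exists (map f ds); rewrite map_inj_uniq ?size_map //.
by split=> //; apply/allP => _ /mapP[d /ad /hf h ->].
Qed.

Lemma stB_adj t z d : adj z d -> adj (stB t z) (stA t d).
Proof. by rewrite adjC => h; rewrite adjC; apply: adj_st. Qed.

Lemma hubsA_ge3 ts z : z \in hubsA ts -> nbrs_ge 3 z.
Proof.
elim: ts z => // t ts IH z; rewrite hubsA_cons in_cons => /predU1P[->|/mapP[y /IH h ->]].
  exists (hubB t (bchain ts) :: pendB t (bchain ts)).
  by rewrite hubB_pendB_uniq hubA_nbrs; case: (t).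
exact: nbrs_ge_map (@stB_inj t) (@adj_st t y) h.
Qed.

Lemma hubsA_ge4 t ts z : z \in hubsA ts -> nbrs_ge 4 (stA t z).
Proof.
move=> hz; have [ds [ud sd /allP ad]] := hubsA_ge3 hz.
exists (hubB t (bchain ts) :: map (stB t) ds); split.
- rewrite /= map_inj_uniq ?ud ?andbT; last exact: stB_inj.
  by apply/mapP => -[y _]; apply: hubB_neq_stB.
- by rewrite /= size_map.
- rewrite /= adj_hubs_st //=; apply/allP => _ /mapP[d /ad h ->]; exact: adj_st.
Qed.

(** The octagon stands at the far end, with no further chain behind it. *)
Fixpoint lasthub (ts : seq bool) : dyck :=
  match ts with
  | [::] => dnil
  | [:: t] => hubB t dnil
  | t :: ts' => stB t (lasthub ts')
  end.

Lemma hubsB_ge4 ts z : z \in hubsB ts -> z = lasthub ts \/ nbrs_ge 4 z.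
Proof.
elim: ts z => // t ts IH z; rewrite hubsB_cons in_cons => /predU1P[->|/mapP[y hy ->]].
  case: ts {IH} => [|t' ts]; [by left|right].
  exists (stA t (hubA t' (achain ts)) :: hubA t (achain (t' :: ts)) :: pendA t (achain (t' :: ts))).
  have h0 : hubA t' (achain ts) \in hubsA (t' :: ts) by rewrite mem_head.
  split; last by apply/andP; split; [rewrite adjC adj_hubs_st|exact: hubB_nbrs].
    rewrite cons_uniq hubA_pendA_uniq andbT; apply/negP => h.
    by apply: (octagonA_new (ts := t' :: ts) _ h erefl); rewrite mem_cat h0.
  by case: (t).
case: (IH _ hy) => [->|h]; first by left; case: ts hy {IH}.
by right; apply: nbrs_ge_map (@stA_inj t) (@stB_adj t y) h.
Qed.

Definition nbr_le1 z := forall d d', adj z d -> adj z d' -> d = d'.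

Lemma pendsA_le1 ts z : z \in pendsA ts -> nbr_le1 z.
Proof.
elim: ts z => // t ts IH z; rewrite pendsA_cons mem_cat => /orP[h d d'|/mapP[y hy ->] d d'].
  by move=> /(pendA_nbr h)-> /(pendA_nbr h)->.
have hi := pendsA_inert hy.
by move=> /(stA_inert_nbr hi)[e -> he] /(stA_inert_nbr hi)[e' -> he']; rewrite (IH _ hy _ _ he he').
Qed.

Lemma pendsB_le1 ts z : z \in pendsB ts -> nbr_le1 z.
Proof.
elim: ts z => // t ts IH z; rewrite pendsB_cons mem_cat => /orP[h d d'|/mapP[y hy ->] d d'].
  by move=> /(pendB_nbr h)-> /(pendB_nbr h)->.
by move=> /stB_nbr[e -> he] /stB_nbr[e' -> he']; rewrite (IH _ hy _ _ he he').
Qed.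

Definition ring_chain m z := exists r xs, z = iter r drot (ring m @+ achain xs).

Lemma hubA_ring_chain t xs : ring_chain 4 (hubA t (achain xs)).
Proof.
have : req (hubA t (achain xs)) (ring 4 @+ achain xs).
  apply: req_trans (_ : req _ (achain xs @+ ring 4)) (req_cat _ _).
  by exists (hub_turn t); case: t; rewrite /hubA; dnorm.
by case/req_sym=> r h; exists r, xs.
Qed.

Lemma lasthub_ring_chain ts : ts != [::] -> ring_chain 4 (lasthub ts).
Proof.
move=> hts; suff [xs /req_sym[r h]] : exists xs, req (lasthub ts) (ring 4 @+ achain xs).
  by exists r, xs.
suff /(_ [::]) : forall us, exists xs, req (achain us @+ lasthub ts) (ring 4 @+ achain xs) by [].
elim: ts hts => // t [|t' ts] IH _ us.
  by exists us; apply: req_trans (req_cat _ _) _; case: (t); apply: req_refl.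
(* The bit of a quadrilateral is a turn of the chain, and it is reversed when the chain is traversed
   backwards. *)
have [xs h] := IH isT (~~ t :: us); exists xs; apply: req_trans h; apply: req_sym.
rewrite [lasthub (t :: _)]/(stB t (lasthub (t' :: ts))); set z := lasthub _.
by case: t; [exists 1|exists 3]; rewrite /stB; dnorm.
Qed.

Lemma ring_chain_nbrs z : ring_chain 4 z -> ~ nbrs_ge 4 z /\ ~ nbr_le1 z.
Proof.
case=> r [xs ->].
have -> : ring 4 @+ achain xs = iter ((dsz (achain xs)).*2 + 5) drot (hubA true (achain xs)).
  by rewrite iterD -(rot_cat (achain xs)) /hubA; dnorm.
rewrite -iterD; move: (r + _) => {}r; split.
  case=> ds [ud sd /allP ad]; have [s hs] := rot_iter_inv r (hubA true (achain xs)).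
  suff : 4 <= size (hubB true (bchain xs) :: pendB true (bchain xs)) by [].
  apply: leq_trans sd _; rewrite -(size_map (iter s drot) ds).
  apply: uniq_leq_size; first by rewrite map_inj_uniq //; apply: iter_rot_inj.
  move=> _ /mapP[d /ad h ->]; apply: hubA_nbr.
  by move: h; rewrite -(adj_iter_rot s) hs.
have /allP h := hubA_nbrs true xs => h1.
have := h1 (iter r drot (hubB true (bchain xs))) (iter r drot (last dnil (pendB true (bchain xs)))).
rewrite !adj_iter_rot !h ?mem_head ?inE ?eqxx ?orbT // => /(_ isT isT) /iter_rot_inj.
by rewrite /hubB /=.
Qed.

(** Degrees decide: a ring chain has at least two and fewer than four neighbours, whereas a pendant
    has at most one, and a hub with the octagon away from both ends, or seen in the other class at
    an end, has at least four. *)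
Lemma ring_chain_octagon t ts z : z \in octagon_component (t :: ts) ->
  ring_chain 4 z <-> z \in [:: hubA t (achain ts); lasthub (t :: ts)].
Proof.
move=> hz; split; last first.
  by rewrite !inE => /orP[] /eqP->; [apply: hubA_ring_chain|apply: lasthub_ring_chain].
case/ring_chain_nbrs=> h4 h1; rewrite !inE.
move: hz; rewrite mem_cat => /orP[]; rewrite mem_cat => /orP[].
- rewrite hubsA_cons in_cons => /predU1P[->|/mapP[y hy e]]; first by rewrite eqxx.
  by case: h4; rewrite e; apply: hubsA_ge4 hy.
- by move/pendsA_le1.
- by case/hubsB_ge4=> [->|//]; rewrite eqxx orbT.
- by move/pendsB_le1.
Qed.

Lemma lasthub_mem t ts : lasthub (t :: ts) \in octagon_component (t :: ts).
Proof.
have h : lasthub (t :: ts) \in hubsB (t :: ts).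
  elim: ts t => [|t' ts IH] t; first by rewrite mem_head.
  by rewrite hubsB_cons in_cons -[lasthub _]/(stB t (lasthub (t' :: ts))) map_f ?orbT.
by rewrite mem_cat [X in _ || X]mem_cat h orbT.
Qed.

Lemma hubA_mem t ts : hubA t (achain ts) \in octagon_component (t :: ts).
Proof. by rewrite !mem_cat mem_head. Qed.

Lemma hubA_neq_lasthub t ts : hubA t (achain ts) != lasthub (t :: ts).
Proof.
have := lasthub_mem t ts; rewrite mem_cat => /orP[]; last first.
  by move=> /topleaf_B hz; apply/eqP => e; move: hz; rewrite -e; case: (t).
move/topleaf_A.
have : topleaf (lasthub (t :: ts)) by case: ts => [|? ?]; case: t => //=; rewrite orbT.
by move->.
Qed.

(** * Rotations of ring chains are distinct *)

(* The points whose edge goes to the next point, in linear and in cyclic order. *)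
Fixpoint hull (d : dyck) : seq bool :=
  if d is arch u v then (u == dnil) :: hull u ++ false :: hull v else [::].
Definition cyc_hull (d : dyck) : seq bool :=
  if d is arch u v then (u == dnil) :: hull u ++ (v == dnil) :: hull v else [::].

Lemma size_hull d : size (hull d) = (dsz d).*2.
Proof. by elim: d => //= u IHu v IHv; rewrite size_cat /= IHu IHv; lia. Qed.

Lemma size_cyc_hull d : size (cyc_hull d) = (dsz d).*2.
Proof. by case: d => //= u v; rewrite size_cat /= !size_hull; lia. Qed.

Lemma hull_cat x y : hull (x @+ y) = hull x ++ hull y.
Proof. by elim: x => //= u _ v ->; rewrite -catA. Qed.

Lemma cyc_hull_rot d : cyc_hull (drot d) = rot 1 (cyc_hull d).
Proof.
case: d => [|[|a b] v] //; rewrite /= rot1_cons //.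
have -> : (b @+ arch v dnil == dnil) = false by case: b.
by rewrite hull_cat -cats1 /= -!catA /= ?catA.
Qed.

Lemma nth_cyc_hull k d i : i < (dsz d).*2 ->
  nth false (cyc_hull (iter k drot d)) i = nth false (cyc_hull d) ((i + k) %% (dsz d).*2).
Proof.
elim: k i => [|k IH] i hi; first by rewrite addn0 modn_small.
rewrite iterS cyc_hull_rot nth_cat size_drop size_cyc_hull dsz_iter_rot nth_drop.
case: ltnP => hk; first by rewrite IH; [congr (nth _ _ (_ %% _)); lia|lia].
have -> : i = (dsz d).*2.-1 by lia.
rewrite nth_take; last by lia.
have -> : (dsz d).*2.-1 - ((dsz d).*2 - 1) = 0 by lia.
rewrite IH; last by lia.
by rewrite add0n addnS -addSn prednK ?modnDl //; lia.
Qed.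

(* No two [true] at distance two: inside a chain no two consecutive hull edges
   follow each other. *)
Fixpoint sparse (s : seq bool) : bool :=
  if s is x :: s' then ~~ (x && nth false s' 1) && sparse s' else true.

Lemma sparse_nth s i : sparse s -> ~~ (nth false s i && nth false s i.+2).
Proof.
elim: s i => [|x s IH] [|i] //=; rewrite ?nth_nil // => /andP[h1 h2] //.
exact: IH.
Qed.

Lemma sparse_cat s r : sparse (s ++ [:: false; false] ++ r) = sparse s && sparse r.
Proof.
elim: s => [|x s IH] //=; rewrite IH andbA; congr (_ && _ && _).
by case: s {IH} => [|y [|z s]].
Qed.

Lemma sparse_rcons s : sparse (rcons s false) = sparse s.
Proof.
elim: s => //= x s ->; congr (~~ (_ && _) && _).
by case: s => [|y [|z s]].
Qed.

Lemma hull_achain ts : ts != [::] ->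
  exists s, hull (achain ts) = false :: rcons (rcons s false) false /\ sparse (false :: s).
Proof.
elim: ts => // t [|t' ts] IH _.
  by exists [:: true]; case: (t).
have [s [hs hp]] := IH isT; move: hs.
rewrite [achain (t :: _)]/(wrap (if t then leaf @+ achain (t' :: ts) else achain (t' :: ts) @+ leaf)).
move: (achain (t' :: ts)) => A hs; case: t.
  exists [:: true, false, false & rcons s false]; split.
    by rewrite /= hs cats1.
  by move: hp; rewrite /= sparse_rcons.
exists (false :: rcons (rcons s false) false ++ [:: true]); split.
  rewrite /wrap [hull _]/= hull_cat hs (_ : (A @+ leaf == dnil) = false); last by case: (A).
  by rewrite -!cats1 /= -!catA.
by rewrite -!cats1 -catA /= -catA sparse_cat andbT.
Qed.

Lemma cyc_hull_ring_chain m ts : 1 < m -> 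
  cyc_hull (ring m @+ achain ts) = hull (ring m @+ achain ts).
Proof. by case: m => [|[|m]]. Qed.

Lemma nth_hull_ring m d i :
  nth false (hull (ring m @+ d)) i = if i < m.*2 then ~~ odd i else nth false (hull d) (i - m.*2).
Proof.
elim: m i => [|m IH] i /=; first by rewrite subn0.
by case: i => [|[|i]] //=; rewrite IH !ltnS !subSS negbK.
Qed.

(** The ring shows [m] hull edges at distance two. A rotation would place this pattern at [k]:
    inside the ring, an odd [k] meets a [false] at once and an even [k > 0] runs into the first
    point of the chain; inside the chain, two hull edges at distance two contradict sparsity. *)
Lemma ring_chain_fixed m ts ts' k : 1 < m -> ts != [::] -> size ts = size ts' ->
  k < (dsz (ring m @+ achain ts)).*2 ->
  ring m @+ achain ts' = iter k drot (ring m @+ achain ts) -> k = 0.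
Proof.
move=> hm hts hsz hk e; case: (posnP k) => // k0; exfalso.
have hd : dsz (ring m @+ achain ts) = m + (size ts).*2 by rewrite dsz_cat dsz_ring dsz_achain.
rewrite hd in hk.
have sz0 : 0 < size ts by case: (ts) hts.
have pat i : i < m ->
   nth false (hull (ring m @+ achain ts)) ((i.*2 + k) %% (m + (size ts).*2).*2).
  move=> hi; rewrite -hd -cyc_hull_ring_chain // -nth_cyc_hull; last by rewrite hd; lia.
  rewrite -e cyc_hull_ring_chain // nth_hull_ring ltn_double hi.
  by rewrite odd_double.
have [s [hs hp]] := hull_achain hts.
have ss : size s = (size ts).*2.*2 - 3.
  by have := size_hull (achain ts); rewrite hs /= !size_rcons dsz_achain; lia.
have last2 j : size s < j -> nth false (hull (achain ts)) j = false.
  move=> hj; rewrite hs; case: j hj => // j; rewrite ltnS /= => hj.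
  by rewrite !nth_rcons size_rcons [j < size s]ltnNge hj /=; case: ifP => _; case: ifP.
case: (ltnP k m.*2) => hkm.
  case ok : (odd k).
    have := pat 0 (ltnW hm); rewrite add0n modn_small // nth_hull_ring hkm ok.
    by [].
  have [j hj] : exists j, k = j.*2 by exists k./2; rewrite -[LHS]odd_double_half ok.
  have := pat (m - j) ltac:(lia); rewrite modn_small; last by lia.
  rewrite nth_hull_ring ifN; last by lia.
  by rewrite (_ : _ - _ = 0) ?hs //; lia.
have h0 := pat 0 (ltnW hm); have h1 := pat 1 hm.
rewrite add0n modn_small // nth_hull_ring ltnNge hkm /= in h0.
(* The last two entries of the chain are [false], so [k] lies before them and [k + 2] does not wrap
   around. *)
case: (leqP (size s).+1 (k - m.*2)) => hks; first by rewrite last2 in h0.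
rewrite modn_small in h1; last by lia.
rewrite nth_hull_ring ifN in h1; last by lia.
have sp : sparse (hull (achain ts)).
  by rewrite hs; move: hp; rewrite -!rcons_cons !sparse_rcons.
have := sparse_nth (k - m.*2) sp.
by rewrite h0 (_ : (k - m.*2).+2 = 1.*2 + k - m.*2) ?h1 //; lia.
Qed.

Lemma ring_chain_inj m ts ts' r r' : 1 < m -> ts != [::] -> size ts = size ts' ->
  r < (m + (size ts).*2).*2 -> r' < (m + (size ts).*2).*2 ->
  iter r drot (ring m @+ achain ts) = iter r' drot (ring m @+ achain ts') ->
  r = r' /\ achain ts = achain ts'.
Proof.
wlog le : ts ts' r r' / r' <= r => [W|] hm hts hsz hr hr' e.
  case: (leqP r' r) => h; first exact: W.
  have hts' : ts' != [::] by rewrite -size_eq0 -hsz size_eq0.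
  rewrite hsz in hr hr'.
  by have [-> ->] := W _ _ _ _ (ltnW h) hm hts' (esym hsz) hr' hr (esym e).
have k0 : r - r' = 0.
  apply: (@ring_chain_fixed m ts ts') => //.
    by rewrite dsz_cat dsz_ring dsz_achain; apply: leq_ltn_trans (leq_subr _ _) hr.
  by apply: (@iter_rot_inj r'); rewrite -iterD subnKC.
have er : r = r' by lia.
split=> //; rewrite er in e; have h := iter_rot_inj e.
by have [] := @dcat_inj (ring m) (ring m) _ _ erefl h.
Qed.

(** The immaterial last bit is fixed. Any earlier bit is visible as the side on which the single
    edge stands, because the rest of the chain does not begin with a single edge. *)
Lemma achain_inj ts ts' : size ts = size ts' ->
  achain (rcons ts false) = achain (rcons ts' false) -> ts = ts'.
Proof.
elim: ts ts' => [|t ts IH] [|t' ts'] //= [hs] [].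
have ne us : exists a b, achain (rcons us false) = wrap (arch a b).
  case: us => [|[] us]; first by exists dnil, dnil.
    by exists dnil, (achain (rcons us false)).
  rewrite [achain _]/(wrap (achain (rcons us false) @+ leaf)).
  by case: (achain _) => [|c d]; [exists dnil, dnil|exists c, (d @+ leaf)].
have [a [b ea]] := ne ts; have [a' [b' ea']] := ne ts'.
case: t; case: t' => e.
- by rewrite (IH ts') //; case: e.
- by move: e; rewrite ea'.
- by move: e; rewrite ea.
- by rewrite (IH ts') //; apply: dcat_injr e.
Qed.

(** * Transfer to matchings of labelled points *)

Definition eset k (e : nat * nat) : edge_t k :=
  [set x : pt k | ((x : nat) == e.1) || ((x : nat) == e.2)].

Definition to_matching k (d : dyck) : matching_t k :=
  [set E in map (eset k) (edges 0 d)].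

Definition valid_edge k (e : nat * nat) := e.1 < e.2 < k.*2.

Lemma edges_valid d (e : nat * nat) : e \in edges 0 d -> valid_edge (dsz d) e.
Proof. by case/edges_range=> _ h1 h2 _; rewrite /valid_edge h1. Qed.

Lemma edges_cover o d i : o <= i < o + (dsz d).*2 ->
  exists2 e : nat * nat, e \in edges o d & (i == e.1) || (i == e.2).
Proof.
elim: d o => [|u IHu v IHv] o /= hi; first by lia.
case: (i =P o) => [->|h0]; first by exists (o, (o + (dsz u).*2).+1); rewrite ?mem_head ?eqxx.
case: (i =P (o + (dsz u).*2).+1) => [->|h1].
  by exists (o, (o + (dsz u).*2).+1); rewrite ?mem_head ?eqxx ?orbT.
case: (leqP i (o + (dsz u).*2)) => h2.
  have [|e he hie] := IHu o.+1; first by lia.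
  by exists e => //; rewrite inE mem_cat he orbT.
have [|e he hie] := IHv (o + (dsz u).*2).+2; first by lia.
by exists e => //; rewrite inE mem_cat he !orbT.
Qed.

Lemma edges_inj o d d' : dsz d = dsz d' ->
  (forall e : nat * nat, e \in edges o d -> e \in edges o d') -> d = d'.
Proof.
elim: d o d' => [|u IHu v IHv] o [|u' v'] //= hs h.
have hu : dsz u = dsz u'.
  have := h _ (mem_head _ _); rewrite inE mem_cat => /or3P[/eqP[] |h'|h']; first lia.
    by have [h1 _ _ _] := edges_range h'; move: h1; rewrite /=; lia.
  by have [h1 _ _ _] := edges_range h'; move: h1; rewrite /=; lia.
have hv : dsz v = dsz v' by lia.
congr arch.
  apply: (IHu o.+1) => // e he; have [h1 h2 h3 _] := edges_range he.
  have := h e; rewrite !inE !mem_cat he orbT => /(_ isT) /or3P[/eqP e0|//|/edges_range[h4 _ _ _]].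
    by move: h1; rewrite e0 /= ltnn.
  by move: h1 h2 h3 h4; rewrite hu; lia.
apply: (IHv (o + (dsz u).*2).+2) => // e he; have [h1 h2 h3 _] := edges_range he.
have := h e; rewrite !inE !mem_cat he !orbT => /(_ isT) /or3P[/eqP e0|/edges_range[_ h4 h5 _]|].
- by move: h1; rewrite e0 /=; lia.
- by move: h1 h2 h3 h4 h5; rewrite hu; lia.
- by rewrite hu.
Qed.

Lemma valid_pt k (e : nat * nat) : valid_edge k e ->
  exists a b : pt k, [/\ (a : nat) = e.1, (b : nat) = e.2 & eset k e = [set a; b]].
Proof.
case/andP=> h1 h2; exists (Ordinal (ltn_trans h1 h2)), (Ordinal h2); split=> //.
by apply/setP => x; rewrite !inE -!val_eqE.
Qed.

Lemma eset_inj k (e f : nat * nat) : valid_edge k e -> valid_edge k f ->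
  eset k e = eset k f -> e = f.
Proof.
move=> he hf h.
have sub (e1 e2 : nat * nat) : valid_edge k e1 -> eset k e1 = eset k e2 ->
    ((e1.1 == e2.1) || (e1.1 == e2.2)) && ((e1.2 == e2.1) || (e1.2 == e2.2)).
  move=> h1 /setP h12; have [a [b [ha hb _]]] := valid_pt h1.
  by have := h12 a; have := h12 b; rewrite !inE ha hb !eqxx orbT /= => <- <-.
have := sub _ _ he h; have := sub _ _ hf (esym h); move: he hf.
by case: e {h} => a b; case: f => c d; rewrite /valid_edge /= => *; congr pair; lia.
Qed.

Lemma interleave_eset k (e f : nat * nat) : valid_edge k e -> valid_edge k f ->
  interleave (eset k e) (eset k f) = [&& e.1 < f.1, f.1 < e.2 & e.2 < f.2].
Proof.
move=> he hf; apply/idP/idP.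
  case/existsP=> a /existsP[b /existsP[c /existsP[d]]]; rewrite !inE.
  by move: he hf; rewrite /valid_edge; lia.
have [a [b [ha hb _]]] := valid_pt he; have [c [d [hc hd _]]] := valid_pt hf.
move=> h; apply/existsP; exists a; apply/existsP; exists b; apply/existsP; exists c.
by apply/existsP; exists d; rewrite !inE ha hb hc hd !eqxx !orbT.
Qed.

Lemma crosses_eset k (e f : nat * nat) : valid_edge k e -> valid_edge k f ->
  crosses (eset k e) (eset k f) = cross e f.
Proof. by move=> he hf; rewrite /crosses !interleave_eset. Qed.

Lemma mem_to_matching k d (E : edge_t k) : reflect
  (exists2 e : nat * nat, e \in edges 0 d & E = eset k e) (E \in to_matching k d).
Proof. by rewrite inE; apply: mapP. Qed.

Lemma to_matchingP k d : dsz d = k -> is_matching (to_matching k d).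
Proof.
move=> hd; have val (e : nat * nat) : e \in edges 0 d -> valid_edge k e by rewrite -hd; apply: edges_valid.
apply/and3P; split.
- apply/forallP => E; apply/implyP => /mem_to_matching[e /val he ->].
  have [a [b [ha hb ->]]] := valid_pt he; rewrite cards2 -val_eqE /= ha hb.
  by move: he => /andP[/ltn_eqF->].
- apply/forallP => x; have [|e he hx] := @edges_cover 0 d x.
    by rewrite hd add0n ltn_ord.
  apply/cards1P; exists (eset k e); apply/setP => E; rewrite !inE.
  apply/andP/eqP => [[/mapP[f hf ->]]|->]; last by rewrite map_f // inE.
  rewrite inE => hxf; congr eset; have := edges_apart hf he.
  by case/orP=> [/eqP //|]; rewrite /apart; lia.
- apply/forallP => E; apply/implyP => /mem_to_matching[e he ->].
  apply/forallP => F; apply/implyP => /mem_to_matching[f hf ->].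
  rewrite crosses_eset ?val //; have := edges_apart he hf.
  by case/orP=> [/eqP ->|/andP[_ ->] //]; rewrite /cross; lia.
Qed.

Lemma to_matching_inj k d d' : dsz d = k -> dsz d' = k ->
  to_matching k d = to_matching k d' -> d = d'.
Proof.
move=> hd hd' /setP h; apply: (@edges_inj 0); first by rewrite hd.
have val x (e : nat * nat) : dsz x = k -> e \in edges 0 x -> valid_edge k e by move=> <-; apply: edges_valid.
move=> e he; have : eset k e \in to_matching k d by rewrite inE map_f.
rewrite h => /mem_to_matching[f hf /eset_inj].
by move=> -> //; [apply: (val d)|apply: (val d')].
Qed.

Lemma dcm_to_matching k d d' : dsz d = k -> dsz d' = k ->
  dcm (to_matching k d) (to_matching k d') = adj d d'.
Proof.
move=> hd hd'; rewrite /dcm !to_matchingP // /disj_compat /adj hd hd' eqxx /=.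
have val (e : nat * nat) : e \in edges 0 d -> valid_edge k e by rewrite -hd; apply: edges_valid.
have val' (e : nat * nat) : e \in edges 0 d' -> valid_edge k e by rewrite -hd'; apply: edges_valid.
apply/andP/allrelP => [[h1 /forallP h2] e f he hf|h].
  apply/andP; split; first apply/eqP.
    move=> ef; move: h1; rewrite disjoint_subset => /subsetP/(_ (eset k e)).
    by rewrite !inE map_f // ef map_f // => /(_ isT).
  have := h2 (eset k e); rewrite inE map_f //= => /forallP/(_ (eset k f)).
  by rewrite inE map_f //= crosses_eset; [|exact: val|exact: val'].
split.
  rewrite disjoint_subset; apply/subsetP => E /mem_to_matching[e he ->].
  rewrite inE; apply/negP => /mem_to_matching[f hf /eset_inj ef].
  have e_f : e = f by apply: ef; [apply: val|apply: val'].
  by have := h _ _ he hf; rewrite e_f /compat eqxx.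
apply/forallP => E; apply/implyP => /mem_to_matching[e he ->].
apply/forallP => F; apply/implyP => /mem_to_matching[f hf ->].
by rewrite crosses_eset; [case/andP: (h _ _ he hf)|apply: val|apply: val'].
Qed.

(** [R] is the partner relation. The partner of the first point splits the interval in two, and by
    non-crossing each part is closed under [R]; these parts become the two arguments of [arch]. *)
Lemma decode (R : rel nat) :
  (forall i j, R i j -> R j i) -> (forall i j j', R i j -> R i j' -> j = j') ->
  (forall i j i' j', R i j -> R i' j' -> i < i' < j -> i <= j' <= j) ->
  forall n o, (forall i, o <= i < o + n -> exists2 j, R i j & (o <= j < o + n) && (i != j)) ->
  exists2 d, (dsz d).*2 = n & forall e : nat * nat, e \in edges o d -> R e.1 e.2.
Proof.
move=> Rsym Rfun Rnc n; elim: n {-2}n (leqnn n) => [|N IH] n hn o hR.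
  by exists dnil => //; move: hn; case: n hR.
case: n => [|n] in hn hR *; first by exists dnil.
have [|j hoj /andP[hj oj]] := hR o; first by lia.
have Ro i : R i o -> i = j by move=> h; apply: Rfun (Rsym _ _ h) hoj.
have Rj i : R i j -> i = o by move=> h; apply: Rfun (Rsym _ _ h) (Rsym _ _ hoj).
have [||u hu Ru] := IH (j - o.+1) _ o.+1; first by lia.
  move=> i hi; have [|i' Ri /andP[hi' ii']] := hR i; first by lia.
  exists i' => //; have := Rnc _ _ _ _ hoj Ri ltac:(lia).
  have n1 : i' <> o by move=> e; move: (Ri); rewrite e => /Ro; lia.
  have n2 : i' <> j by move=> e; move: (Ri); rewrite e => /Rj; lia.
  by lia.
have [||v hv Rv] := IH (o + n.+1 - j.+1) _ j.+1; first by lia.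
  move=> i hi; have [|i' Ri /andP[hi' ii']] := hR i; first by lia.
  exists i' => //.
  have n1 : i' <> o by move=> e; move: (Ri); rewrite e => /Ro; lia.
  have n2 : i' <> j by move=> e; move: (Ri); rewrite e => /Rj; lia.
  have n3 : ~ (o < i' < j) by move=> h; have := Rnc _ _ _ _ hoj (Rsym _ _ Ri) h; lia.
  by lia.
exists (arch u v) => [|e]; first by rewrite /=; lia.
have ej : (o + (dsz u).*2).+1 = j by lia.
by rewrite /= ej inE mem_cat => /or3P[/eqP-> //|/Ru //|/Rv].
Qed.

Lemma to_matching_surj k (M : matching_t k) : is_matching M ->
  exists2 d, dsz d = k & M = to_matching k d.
Proof.
case/and3P=> /forallP h2 /forallP h1 /forallP hnc.
pose R i j := [&& i < k.*2, j < k.*2 & eset k (i, j) \in M].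
have card2 E : E \in M -> #|E| = 2 by move=> hE; apply/eqP; have := h2 E; rewrite hE.
have uniqE (x : pt k) E F : E \in M -> F \in M -> x \in E -> x \in F -> E = F.
  move=> hE hF xE xF; have /cards1P[G hG] := h1 x.
  have : E \in [set e in M | x \in e] by rewrite inE hE.
  have : F \in [set e in M | x \in e] by rewrite inE hF.
  by rewrite hG !inE => /eqP-> /eqP->.
have esetC i j : eset k (i, j) = eset k (j, i) by apply/setP => x; rewrite !inE orbC.
have Rne i j : R i j -> i != j.
  case/and3P=> hi hj hM; apply/eqP => ij; have := card2 _ hM.
  have -> : eset k (i, j) = [set Ordinal hi] by apply/setP => x; rewrite !inE -ij orbb -val_eqE.
  by rewrite cards1.
have [||||d hd hdR] := @decode R _ _ _ k.*2 0.
- by move=> i j /and3P[hi hj h]; apply/and3P; rewrite esetC.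
- move=> i j j' Rij Rij'; have hne := Rne _ _ Rij; have hne' := Rne _ _ Rij'.
  case/and3P: Rij => hi hj hM; case/and3P: Rij' => _ hj' hM'.
  have /setP/(_ (Ordinal hj)) : eset k (i, j) = eset k (i, j').
    by apply: (uniqE (Ordinal hi)) => //; rewrite !inE eqxx.
  by rewrite !inE /= eqxx orbT eq_sym (negPf hne) /= => /esym/eqP.
- move=> i j i' j' /and3P[hi hj hM] /and3P[hi' hj' hM'] hlt.
  have := hnc (eset k (i, j)); rewrite hM => /forallP/(_ (eset k (i', j'))).
  rewrite hM' /=; case: (ltngtP i' j') => hij'.
  + by rewrite crosses_eset /valid_edge /cross /=; lia.
  + by rewrite (esetC i') crosses_eset /valid_edge /cross /=; lia.
  + by lia.
- move=> i hi; rewrite add0n in hi; have hi' : i < k.*2 by lia.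
  have /cards1P[E hE] := h1 (Ordinal hi').
  have : E \in [set e in M | Ordinal hi' \in e] by rewrite hE inE.
  rewrite inE => /andP[EM iE]; have /eqP/cards2P[a [b [hab Eab]]] := card2 _ EM.
  have [j hj] : exists2 j : pt k, E = eset k (i, j : nat) & i != j.
    move: iE; rewrite Eab !inE => /orP[] /eqP ei.
      exists b; last by have := hab; rewrite -ei -val_eqE.
      by apply/setP => x; rewrite !inE -ei -!val_eqE.
    exists a; last by have := hab; rewrite -ei eq_sym -val_eqE.
    by apply/setP => x; rewrite !inE -ei -!val_eqE orbC.
  move=> hne; exists (j : nat); first by rewrite /R hi' ltn_ord -hj.
  by rewrite ltn_ord.
have hk : dsz d = k by apply: double_inj.
exists d => //; apply/setP => E; apply/idP/mem_to_matching => [EM|[e /hdR /and3P[_ _]]]; last first.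
  by move=> h ->; rewrite (surjective_pairing e).
have /card_gt0P[x xE] : 0 < #|E| by rewrite card2.
have [|e he hx] := @edges_cover 0 d x; first by rewrite hd add0n ltn_ord.
exists e => //; apply: (uniqE x) => //; last by rewrite inE.
by have /and3P[_ _] := hdR _ he; rewrite -surjective_pairing.
Qed.

Lemma connect_to_matching k d (M : matching_t k) : dsz d = k ->
  connect (@dcm k) (to_matching k d) M <-> exists2 d', conn d d' & M = to_matching k d'.
Proof.
move=> hd; split.
  case/connectP=> p; elim: p d hd => [|N p IH] d hd /=; first by move=> _ ->; exists d; [apply: conn_refl|].
  case/andP=> hN hp hM; have [e he eN] : exists2 e, dsz e = k & N = to_matching k e.
    by apply: to_matching_surj; case/and3P: hN.
  subst N; have [d' h1 h2] := IH e he hp hM; exists d' => //.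
  by apply: conn_step h1; rewrite -(@dcm_to_matching k).
case=> d' h ->; elim: h hd => {d d'} [x _|x y z h _ IH hx]; first exact: connect0.
have hy : dsz y = k by rewrite -(adj_sz h).
by apply: connect_trans (IH hy); apply: connect1; rewrite dcm_to_matching.
Qed.

(** * Counting *)

Lemma mem_component k d e : dsz d = k -> dsz e = k ->
  (to_matching k e \in component (to_matching k d)) <-> conn d e.
Proof.
move=> hd he; rewrite inE; split.
  case/(connect_to_matching _ hd)=> d' hc h.
  have hd' : dsz d' = k by rewrite -(conn_sz hc).
  by rewrite (to_matching_inj he hd' h).
by move=> hc; apply/(connect_to_matching _ hd); exists e.
Qed.

Lemma component_eq k d e : dsz d = k -> dsz e = k ->
  (component (to_matching k d) == component (to_matching k e)) <-> conn d e.
Proof.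
move=> hd he; split.
  move/eqP=> h; apply/(mem_component hd he); rewrite h.
  by apply/(mem_component he he); apply: conn_refl.
move=> hde; apply/eqP/setP => M; rewrite !inE.
apply/idP/idP.
  case/(connect_to_matching _ hd)=> x hx ->; apply/(connect_to_matching _ he); exists x => //.
  exact: conn_trans (conn_sym hde) hx.
case/(connect_to_matching _ he)=> x hx ->; apply/(connect_to_matching _ hd); exists x => //.
exact: conn_trans hde hx.
Qed.

Lemma componentsP k (C : {set matching_t k}) :
  C \in components k -> exists2 d, dsz d = k & C = component (to_matching k d).
Proof.
case/imsetP=> M; rewrite inE => /to_matching_surj[d hd ->] ->; by exists d.
Qed.

Lemma component_components k d : dsz d = k -> component (to_matching k d) \in components k.
Proof. by move=> hd; apply: imset_f; rewrite inE to_matchingP. Qed.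

Lemma card_component k d (s : seq dyck) : dsz d = k -> uniq s ->
  (forall e, conn d e <-> e \in s) -> #|component (to_matching k d)| = size s.
Proof.
move=> hd us hs; have hk e : e \in s -> dsz e = k by move=> /hs/conn_sz <-.
rewrite -(size_map (to_matching k)) -(card_uniqP _); last first.
  rewrite map_inj_in_uniq // => x y hx hy; exact: to_matching_inj (hk _ hx) (hk _ hy).
apply: eq_card => M; rewrite inE; apply/idP/mapP.
  by case/(connect_to_matching _ hd)=> e /hs he ->; exists e.
by case=> e /hs he ->; apply/(connect_to_matching _ hd); exists e.
Qed.

Lemma card_component_ge k d (s : seq dyck) : dsz d = k -> uniq s ->
  (forall e, e \in s -> conn d e) -> size s <= #|component (to_matching k d)|.
Proof.
move=> hd us hs; have hk e : e \in s -> dsz e = k by move=> /hs/conn_sz <-.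
rewrite -(size_map (to_matching k)) -(card_uniqP _); last first.
  rewrite map_inj_in_uniq // => x y hx hy; exact: to_matching_inj (hk _ hx) (hk _ hy).
apply/subset_leq_card/subsetP => _ /mapP[e he ->].
by apply/(mem_component hd (hk _ he)); apply: hs.
Qed.

Lemma card_component_small k d : dsz d = k -> small d -> 0 < k ->
  #|component (to_matching k d)| = 2.
Proof.
move=> hd hs hk; have [y [ay sy uy]] := small_adj hs; have [z [az sz uz]] := small_adj sy.
have ez : z = d by rewrite (uz d) // adjC.
have nd : d != y.
  apply/eqP => e; move: ay; rewrite -e; case: (d) hd => [|u v] hd; first by move: hk; rewrite -hd.
  by case/andP=> _ /allrelP/(_ _ _ (mem_head _ _) (mem_head _ _)); rewrite /compat eqxx.
rewrite (@card_component k d [:: d; y]) //= ?inE ?nd // => e; split.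
  suff h x w : conn x w -> x \in [:: d; y] -> w \in [:: d; y] by move/h; apply; rewrite mem_head.
  elim=> // {}x {}w v hxw _ IH hx; apply: IH; move: hx; rewrite !inE.
  case/orP=> /eqP ex; rewrite ex in hxw.
    by rewrite (uy _ hxw) eqxx orbT.
  by rewrite (uz _ hxw) ez eqxx.
rewrite !inE => /orP[] /eqP->; [exact: conn_refl|exact: conn1].
Qed.

Lemma conn_unrot r x z : conn (iter r drot x) z -> exists2 y, z = iter r drot y & conn x y.
Proof.
move ew: (iter r drot x) => w h; elim: h x ew => [{}w|{}w v {}z hwv _ IH] x ew.
  by exists x => //; apply: conn_refl.
move: hwv; rewrite -ew => /adj_unrot[y ey hxy].
have [u eu hu] := IH y (esym ey); exists u => //; exact: conn_step hxy hu.
Qed.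

Lemma ring_chain_iter_rot m t z : ring_chain m z <-> ring_chain m (iter t drot z).
Proof.
split=> [[r' [us ->]]|[r' [us h]]]; first by exists (t + r'), us; rewrite iterD.
by have [u hu] := rot_iter_inv t z; exists (u + r'), us; rewrite iterD -h hu.
Qed.

Lemma ring_chain_component z : ring_chain 4 z -> exists (xs : seq bool) (s : seq dyck),
  [/\ dsz z = 4 + (size xs).*2, uniq s, size s = 6 * (size xs).+1,
  forall e, conn z e <-> e \in s &
  exists a b, [/\ a != b, a \in s, b \in s &
    forall y, y \in s -> ring_chain 4 y <-> y \in [:: a; b]]].
Proof.
case=> r [xs ez]; exists xs.
have hz : dsz z = 4 + (size xs).*2 by rewrite ez dsz_iter_rot dsz_cat dsz_achain.
have [t ht] : req (hubA true (achain xs)) z.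
  apply: req_trans (_ : req _ (achain xs @+ ring 4)) _.
    by exists (hub_turn true); rewrite /hubA; dnorm.
  by apply: req_trans (req_cat _ _) _; exists r.
(* The bit [true] is an arbitrary choice: for either bit the first hub is a rotation of the ring
   with its chain. *)
pose K := octagon_component (true :: xs).
exists (map (iter t drot) K); have inj := @iter_rot_inj t; split=> //.
- by rewrite map_inj_uniq ?octagon_component_uniq.
- by rewrite size_map size_octagon_component.
- move=> e; rewrite ht; split.
    case/conn_unrot=> y -> hy; rewrite mem_map //.
    exact: octagon_closed_conn (hubA_mem true xs) hy.
  by case/mapP=> y hy ->; apply: conn_iter_rot; apply: octagon_conn.
exists (iter t drot (hubA true (achain xs))), (iter t drot (lasthub (true :: xs))).
rewrite (inj_eq inj) hubA_neq_lasthub !mem_map // hubA_mem lasthub_mem; split=> //.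
move=> _ /mapP[y hy ->]; rewrite -ring_chain_iter_rot.
rewrite -[[:: _; _]]/(map (iter t drot) [:: hubA true (achain xs); lasthub (true :: xs)]).
by rewrite mem_map //; apply: ring_chain_octagon.
Qed.

Lemma med_ring_chain d : med d -> exists2 z, ring_chain 4 z & conn d z.
Proof. by case=> r [xs h]; exists (iter r drot (ring 4 @+ achain xs)) => //; exists r, xs. Qed.

Lemma card_component_med l d : dsz d = l.*2 -> med d ->
  #|component (to_matching l.*2 d)| = 6 * l - 6.
Proof.
move=> hd /med_ring_chain[z hz hc]; have [xs [s [sz us ss hs _]]] := ring_chain_component hz.
rewrite (@card_component _ _ s) // => [|e]; last first.
  by rewrite -hs; split; apply: conn_trans; [apply: conn_sym|].
by have := conn_sz hc; rewrite ss hd sz; lia.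
Qed.

Lemma card_component_big l d : dsz d = l.*2 -> big d ->
  6 * l - 6 < #|component (to_matching l.*2 d)|.
Proof.
move=> hd hb; have [s [us ss hs]] := big_component hb hd.
exact: leq_trans ss (card_component_ge hd us hs).
Qed.

(** The chain has [n.+1] quadrilaterals but only [n] free bits; the rotations range over the number
    of points. *)
Definition ring_chain_at m n (p : 'I_((m + n.+1.*2).*2) * n.-tuple bool) :=
  to_matching (m + n.+1.*2) (iter p.1 drot (ring m @+ achain (rcons p.2 false))).

Definition ring_chains m n : {set matching_t (m + n.+1.*2)} :=
  [set ring_chain_at p | p : 'I_((m + n.+1.*2).*2) * n.-tuple bool].

Lemma dsz_ring_chain m n r (t : seq bool) : size t = n ->
  dsz (iter r drot (ring m @+ achain (rcons t false))) = m + n.+1.*2.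
Proof. by move=> ht; rewrite dsz_iter_rot dsz_cat dsz_ring dsz_achain size_rcons ht. Qed.

Lemma card_ring_chains m n : 1 < m -> #|ring_chains m n| = (m + n.+1.*2).*2 * 2 ^ n.
Proof.
move=> hm; rewrite card_imset; first by rewrite card_prod card_ord card_tuple card_bool.
move=> [r t] [r' t'] /= /to_matching_inj.
rewrite !(@dsz_ring_chain _ n) ?size_tuple // => /(_ erefl erefl) h.
have [||||| er et] := ring_chain_inj _ _ _ _ _ h => //.
- by case: (tval t).
- by rewrite !size_rcons !size_tuple.
- by rewrite size_rcons size_tuple.
- by rewrite size_rcons size_tuple.
congr pair; first exact: val_inj.
by apply/val_inj/(achain_inj _ et); rewrite !size_tuple.
Qed.

Lemma achain_last (ts : seq bool) n : size ts = n.+1 ->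
  exists t : n.-tuple bool, achain ts = achain (rcons t false).
Proof.
case/lastP: ts => // ts b; rewrite size_rcons => -[hs].
exists (tcast hs (in_tuple ts)); rewrite val_tcast /=.
by elim: ts {hs} => [|t ts /= ->] //; case: b.
Qed.

Lemma mem_ring_chains m n d : dsz d = m + n.+1.*2 ->
  (to_matching (m + n.+1.*2) d \in ring_chains m n) <-> ring_chain m d.
Proof.
move=> hd; split.
  case/imsetP=> -[r t] _ /to_matching_inj ->; rewrite ?(@dsz_ring_chain _ n) ?size_tuple //.
  by exists r, (rcons t false).
case=> r [xs e]; have hx : size xs = n.+1.
  by move: hd; rewrite e dsz_iter_rot dsz_cat dsz_ring dsz_achain; lia.
have [t et] := achain_last hx; rewrite et in e.
have hr : r %% (m + n.+1.*2).*2 < (m + n.+1.*2).*2 by rewrite ltn_mod; lia.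
apply/imsetP; exists (Ordinal hr, t) => //=; congr to_matching; rewrite e.
set x := _ @+ _; have hx' : dsz x = m + n.+1.*2 by rewrite -(dsz_iter_rot r) -e.
rewrite {1}(divn_eq r (m + n.+1.*2).*2) addnC iterD; congr iter.
by rewrite -hx'; elim: (r %/ _) => // q IH; rewrite mulSn iterD IH rot_period.
Qed.

(** The quadrilaterals of [ys] pass one by one to the other side, with reversed bits, until a single
    one remains; its two edges form the ring. *)
Lemma small_ring_chain d : 0 < dsz d -> small d -> ring_chain 2 d.
Proof.
move=> d0 /small_req_ab[xs [ys h]].
suff [zs hz] : exists zs, req (achain xs @+ bchain ys) (ring 2 @+ achain zs).
  by have [r ->] := req_sym (req_trans h hz); exists r, zs.
have {d0 h} : 0 < size xs + size ys.
  by move: (req_sz h); rewrite dsz_cat dsz_achain dsz_bchain; lia.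
elim: ys xs => [|y ys IH] xs.
  rewrite dcat0; case: xs => [|[] xs] // _; exists xs.
    apply: req_trans (_ : req _ (leaf @+ achain xs @+ leaf)) _.
      by exists 1; dnorm.
    by have := req_cat (leaf @+ achain xs) leaf; dnorm.
  apply: req_trans (_ : req _ (achain xs @+ ring 2)) (req_cat _ _).
  by exists 1; dnorm.
move=> _; case: ys IH => [|y' ys] IH.
  by exists xs; have := req_cat (achain xs) (ring 2); case: (y).
have {}IH us : exists zs, req (achain us @+ bchain (y' :: ys)) (ring 2 @+ achain zs).
  by apply: IH; rewrite addnS.
have -> : bchain [:: y, y' & ys] = stB y (bchain (y' :: ys)) by [].
move: (bchain (y' :: ys)) IH => B IH.
have [zs hz] := IH (~~ y :: xs); exists zs; apply: req_trans hz; rewrite /stB; case: y.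
  by apply: req_sym; exists 1; dnorm.
apply: req_trans (req_cat _ _) _; apply: req_trans (_ : req _ (B @+ achain (true :: xs))) (req_cat _ _).
by exists 1; dnorm.
Qed.

(** Double counting: [S] is partitioned by the component to which its members belong. *)
Lemma card_components_double k (S : {set matching_t k}) (F : {set {set matching_t k}}) :
  F \subset components k ->
  (forall d, dsz d = k -> to_matching k d \in S -> component (to_matching k d) \in F) ->
  S \subset [set M | is_matching M] ->
  (forall C, C \in F -> #|C :&: S| = 2) -> #|S| = #|F| * 2.
Proof.
move=> hF hS hM h2; rewrite -sum1_card (partition_big (@component k) [in F]) /=; last first.
  move=> M MS; have := subsetP hM _ MS; rewrite inE => /to_matching_surj[d hd e].
  by rewrite e in MS *; apply: hS.
rewrite -sum_nat_const; apply: eq_bigr => C CF; rewrite -(h2 _ CF) sum1dep_card.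
apply: eq_card => M; rewrite !inE [RHS]andbC; apply: andb_id2l => MS.
have := subsetP hM _ MS; rewrite inE => /to_matching_surj[d hd ->].
have [e he ->] := componentsP (subsetP hF _ CF).
by apply/idP/idP => [/(component_eq hd he)/conn_sym/(mem_component he hd)|
  /(mem_component he hd)/conn_sym/(component_eq hd he)].
Qed.

Lemma med_sz d l : dsz d = l.*2 -> med d -> 1 < l.
Proof.
by move=> hd [r [xs /conn_sz]]; rewrite hd dsz_iter_rot dsz_cat dsz_achain /=; lia.
Qed.

Lemma big_sz d l : dsz d = l.*2 -> big d -> 2 < l.
Proof. by move=> hd /big_conn_ring[[h _]|[h _]|[m [_ h _]]]; lia. Qed.

Lemma components_trichotomy l (C : {set matching_t l.*2}) : 0 < l -> C \in components l.*2 ->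
  exists2 d, dsz d = l.*2 /\ C = component (to_matching l.*2 d) &
  [\/ small d /\ #|C| = 2, [/\ med d, 1 < l & #|C| = 6 * l - 6]
    | 2 < l /\ 6 * l - 6 < #|C|].
Proof.
move=> l0 /componentsP[d hd ->]; exists d => //.
have : trich d by apply: (@trichotomy l.-1); rewrite prednK.
case.
- by move=> h; apply: Or31; split=> //; apply: card_component_small => //; lia.
- by move=> h; apply: Or32; split=> //; [apply: med_sz hd h|apply: card_component_med].
- by move=> h; apply: Or33; split; [apply: big_sz hd h|apply: card_component_big].
Qed.

Lemma ring_chain_small d : ring_chain 2 d -> small d.
Proof. by case=> r [xs ->]; apply: small_req (small_ba [:: true] xs); exists r. Qed.

Lemma ring_chain_med d : ring_chain 4 d -> med d.
Proof. by case=> r [xs ->]; exists r, xs; apply: conn_refl. Qed.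

Lemma ring_chains_matching m n : ring_chains m n \subset [set M | is_matching M].
Proof.
apply/subsetP => _ /imsetP[p _ ->]; rewrite inE.
by apply: to_matchingP; rewrite (@dsz_ring_chain _ n) ?size_tuple.
Qed.

Lemma card_small_components l : 0 < l ->
  #|[set C in components l.*2 | #|C| == 2]| = l * 2 ^ (l - 1).
Proof.
case: l => // -[_|n _].
  (* For [l = 1] there is no chain and the rotations of [ring 2] repeat, so the two matchings are
     listed directly. *)
  apply/eqP/cards1P; exists (component (to_matching 2 quadA)).
  apply/setP => C; rewrite !inE; apply/andP/eqP => [[/componentsP[d hd ->] _]|->].
    apply/eqP/(@component_eq 2 d quadA hd erefl).
    have : d \in forests 2 by have := mem_forests d; rewrite hd.
    rewrite [forests 2](_ : _ = [:: quadB; quadA]) // !inE => /orP[] /eqP->; last exact: conn_refl.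
    exact: conn1.
  split; first exact: component_components.
  apply/eqP/card_component_small => //; exact: (small_ab [:: true] [::]).
apply/eqP; rewrite -(eqn_pmul2r (isT : 0 < 2)); apply/eqP.
rewrite -(@card_components_double _ (ring_chains 2 n)).
- by rewrite (@card_ring_chains 2 n) // subn1 /= expnS; lia.
- by apply/subsetP => C; rewrite inE => /andP[].
- move=> d hd /(mem_ring_chains hd) /ring_chain_small hs.
  by rewrite inE component_components // card_component_small.
- exact: ring_chains_matching.
(* Both vertices of a small component are ring chains, so the intersection is all of [C]. *)
move=> C; rewrite inE => /andP[hC /eqP h2]; rewrite -[RHS]h2; congr #|pred_of_set _|.
apply/setIidPl/subsetP => M.
have [d [hd eC] hcase] := components_trichotomy (isT : 0 < n.+2) hC.
have hs : small d by case: hcase => [[] //|[_ _]|[_]]; rewrite h2; lia.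
rewrite eC inE => /(connect_to_matching _ hd)[e he ->].
have hde : dsz e = n.+2.*2 by rewrite -(conn_sz he).
apply/(@mem_ring_chains 2 n _ hde)/small_ring_chain; first by rewrite hde.
exact: small_conn he hs.
Qed.

Lemma card_med_components l : 2 < l ->
  #|[set C in components l.*2 | #|C| == 6 * l - 6]| = l * 2 ^ (l - 2).
Proof.
case: l => [|[|[|n]]] // _; set k := n.+3.*2.
apply/eqP; rewrite -(eqn_pmul2r (isT : 0 < 2)); apply/eqP.
rewrite -(@card_components_double _ (ring_chains 4 n)).
- by rewrite (@card_ring_chains 4 n) // !subSS subn0 expnS; lia.
- by apply/subsetP => C; rewrite inE => /andP[].
- move=> d hd /(mem_ring_chains hd) /ring_chain_med hs.
  rewrite inE component_components //; apply/eqP.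
  exact: (@card_component_med n.+3 d hd hs).
- exact: ring_chains_matching.
move=> C; rewrite inE => /andP[hC /eqP h2].
have [d [hd eC] hcase] := components_trichotomy (isT : 0 < n.+3) hC.
have hm : med d by case: hcase => [[_]|[]|[_]] //; rewrite h2; lia.
have [z hz hdz] := med_ring_chain hm.
have [xs [s [_ _ _ hs [a [b [nab sa sb hab]]]]]] := ring_chain_component hz.
have sz e : conn d e -> dsz e = k by move/conn_sz <-.
have cd e : e \in s -> conn d e by move=> /hs; apply: conn_trans.
(* In [a] and [b] the octagon stands at the two ends of the chain. *)
have -> : C :&: ring_chains 4 n = [set to_matching k a; to_matching k b].
  apply/setP => M; rewrite eC !inE; apply/andP/orP.
    case=> /(connect_to_matching _ hd)[e he ->] hM.
    have hse : e \in s by apply/hs; apply: conn_trans (conn_sym hdz) he.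
    have := (hab _ hse).1 ((@mem_ring_chains 4 n _ (sz _ he)).1 hM).
    by rewrite !inE => /orP[] /eqP->; [left|right].
  have hin e : e \in s -> e \in [:: a; b] -> connect (@dcm k) (to_matching k d) (to_matching k e) /\
      to_matching k e \in ring_chains 4 n.
    move=> hse he; split; first by apply/(connect_to_matching _ hd); exists e; rewrite ?cd //; apply: cd.
    by apply/(@mem_ring_chains 4 n _ (sz _ (cd _ hse)))/(hab _ hse).
  by case=> /eqP->; apply: hin; rewrite ?inE ?eqxx ?orbT.
rewrite cards2; case: eqP => // /(to_matching_inj (sz _ (cd _ sa)) (sz _ (cd _ sb))) e.
by rewrite e eqxx in nab.
Qed.

Theorem theorem3 (k : nat) (hk : (1 <= k)%N) (hev : ~~ odd k) :
  let l := k./2 in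
  (* (1) smallest order is 2, with l * 2^(l-1) such components *)
  ((forall C, C \in components k -> (2 <= #|C|)%N) /\
   (exists2 C, C \in components k & #|C| = 2) /\
   #|[set C in components k | #|C| == 2]| = (l * 2 ^ (l - 1))%N) /\
  (* (2) second smallest order is 6l-6 (k >= 4), with l * 2^(l-2) such
         components (k >= 6) *)
  ((4 <= k)%N ->
     (forall C, C \in components k -> #|C| <> 2 -> (6 * l - 6 <= #|C|)%N) /\
     (exists2 C, C \in components k & #|C| = (6 * l - 6)%N) /\
     ((6 <= k)%N ->
        #|[set C in components k | #|C| == (6 * l - 6)%N]| = (l * 2 ^ (l - 2))%N)).
Proof.
move=> l; have ek : k = l.*2 by rewrite -[LHS]odd_double_half (negPf hev).
move: l ek => l ek; subst k.
have l0 : 0 < l by lia.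
split; [split; [|split]|].
- move=> C /(components_trichotomy l0)[d _ [[_ ->]|[_ h ->]|[h1 h2]]] //; first lia.
  by apply: leq_trans (ltnW h2); lia.
- have hd : dsz (achain (nseq l true)) = l.*2 by rewrite dsz_achain size_nseq.
  exists (component (to_matching l.*2 (achain (nseq l true)))).
    exact: component_components.
  apply: card_component_small => //.
  by have := small_ab (nseq l true) [::]; rewrite dcat0.
- exact: card_small_components.
move=> k4; split; [|split].
- by move=> C /(components_trichotomy l0)[d _ [[_ ->]|[_ h ->]|[h1 h2]]] // _; apply: ltnW.
- have hd : dsz (ring 4 @+ achain (nseq (l - 2) true)) = l.*2.
    by rewrite dsz_cat dsz_ring dsz_achain size_nseq; lia.
  exists (component (to_matching l.*2 (ring 4 @+ achain (nseq (l - 2) true)))).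
    exact: component_components.
  exact: card_component_med hd (med_ring _).
- by move=> k6; apply: card_med_components; lia.
Qed.
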